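(* Let $X$ be a Cantor space and let $K$ be a dynamical simplex on $X$. Then a generic element of $G_K^*$ is $K$-saturated, i.e. the set of $K$-saturated homeomorphisms belonging to $G_K^*$ is comeager in $G_K^*$. In particular, for a generic element $g$ of $G_K^*$ (i.e. for all $g$ in a comeager subset of $G_K^*$), the set of $g$-invariant Borel probability measures on $X$ is equal to $K$.
   Context: $X$ is a Cantor space and $\mathrm{Clopen}(X)$ is the set of its clopen subsets. A dynamical simplex on $X$ is a nonempty compact (for the weak-* topology) convex set $K$ of Borel probability measures on $X$ such that: (i) every $\mu\in K$ is atomless and has full support; (ii) for all $A,B\in\mathrm{Clopen}(X)$ with $\mu(A)<\mu(B)$ for all $\mu\in K$, there is a clopen $\tilde A\subseteq B$ with $\mu(\tilde A)=\mu(A)$ for all $\mu\in K$. $G_K=\{g\in \mathrm{Homeo}(X): g_*\mu=\mu \text{ for all }\mu\in K\}$, where $g_*\mu(A)=\mu(g^{-1}A)$. It is a Polish group for the topology in which a neighborhood basis of the identity is given by the subgroups $\{g\in G_K: g(A)=A \text{ for all } A\in\mathcal A\}$, where $\mathcal A$ ranges over all (finite) clopen partitions of $X$. $G_K^*$ is the set of all $g\in G_K$ such that $g(U)\ne U$ for every clopen $U$ with $U\neq\emptyset$, $U\ne X$; it is a closed subset of $G_K$ and is given the subspace topology. ''Generic'' is in the sense of Baire category in $G_K^*$. A Kakutani-Rokhlin partition for $g\in\mathrm{Homeo}(X)$ is a finite partition $(A_{i,j})_{i\in I,\,0\le j\le n_i}$ of $X$ into nonempty clopen sets such that $g(A_{i,j})=A_{i,j+1}$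 whenever $0\le j<n_i$. An element $g\in G_K$ is $K$-saturated if whenever $A,B\in\mathrm{Clopen}(X)$ satisfy $\mu(A)=\mu(B)$ for all $\mu\in K$, there exists a Kakutani-Rokhlin partition $(A_{i,j})_{i\in I,\,0\le j\le n_i}$ for $g$ such that $A$ and $B$ are unions of atoms of this partition and, for all $i\in I$, $|\{j: A_{i,j}\subseteq A\}|=|\{j: A_{i,j}\subseteq B\}|$. *)

(* Defs.v *)
From HB Require Import structures.
From mathcomp Require Import all_boot all_order all_algebra.
From mathcomp Require Import all_classical all_reals all_analysis.

Set Implicit Arguments.
Unset Strict Implicit.
Unset Printing Implicit Defensive.

Import Order.TTheory GRing.Theory Num.Theory.
Import numFieldNormedType.Exports.

Local Open Scope classical_set_scope.
Local Open Scope ring_scope.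

Definition homeomorphism (S T : topologicalType) (f : S -> T) : Prop :=
  continuous f /\
  exists f' : T -> S, [/\ continuous f', cancel f f' & cancel f' f].

Definition is_cantor_space (X : topologicalType) : Prop :=
  exists f : cantor_space -> X, homeomorphism f.

Definition comeager (T : topologicalType) (S : set T) : Prop :=
  exists U : nat -> set T,
    (forall n, open (U n) /\ dense (U n)) /\ \bigcap_n U n `<=` S.

Definition borel (X : ptopologicalType) := g_sigma_algebraType (@open X).

(* The library's measures are functions on all sets, unconstrained outside the
   sigma-algebra, so that several of them represent the same Borel measure.
   Requiring the value 0 on non-Borel sets selects one representative of each
   (bprob_eq, bprob_exists). *)
Record bprob (X : ptopologicalType) (R : realType) := BProb {
  bprob_val :> probability (borel X) R ;
  bprob_out : forall A : set (borel X), ~ measurable A -> bprob_val A = 0%E }.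

Lemma bprob_eq (X : ptopologicalType) (R : realType) (mu nu : bprob X R) :
  (forall A : set (borel X), measurable A -> mu A = nu A) -> mu = nu.
Proof.
case: mu nu => [m m0] [n n0] /= mn.
have {}mn : (m : set (borel X) -> \bar R) = n.
  apply/funext => A; have [/mn//|nA] := pselect (measurable A).
  by rewrite m0 ?n0.
have e : m = n.
  case: m n mn {m0 n0} => [m cm] [n cn] /= mn; subst n.
  move: cm cn => [[a1 a2] [b] [c] [d] [e] [f] [g]].
  move=> [[a1' a2'] [b'] [c'] [d'] [e'] [f'] [g']].
  have ? := Prop_irrelevance a1 a1'; subst a1'.
  have ? := Prop_irrelevance a2 a2'; subst a2'.
  have ? := Prop_irrelevance b b'; subst b'.
  have ? := Prop_irrelevance c c'; subst c'.
  have ? := Prop_irrelevance d d'; subst d'.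
  have ? := Prop_irrelevance e e'; subst e'.
  have ? := Prop_irrelevance f f'; subst f'.
  by have ? := Prop_irrelevance g g'; subst g'.
by subst n; congr BProb; exact: Prop_irrelevance.
Qed.

Lemma bprob_exists (X : ptopologicalType) (R : realType)
    (P : probability (borel X) R) :
  exists mu : bprob X R, forall A : set (borel X), measurable A -> mu A = P A.
Proof.
pose m (A : set (borel X)) : \bar R := if pselect (measurable A) then P A else 0%E.
have mE A : measurable A -> m A = P A by rewrite /m; case: pselect.
have m0 : m set0 = 0%E by rewrite mE ?measure0.
have m_ge0 A : (0 <= m A)%E by rewrite /m; case: pselect => ? /=; rewrite ?measure_ge0 ?lexx.
have m_add : semi_sigma_additive m.
  move=> F mF tF mUF; rewrite mE//.
  under eq_fun do under eq_bigr do rewrite mE//.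
  exact: measure_semi_sigma_additive.
pose M := isMeasure.Build _ _ _ m m0 m_ge0 m_add.
pose mu : {measure set (borel X) -> \bar R} := HB.pack m M.
have mu1 : mu setT = 1%E by rewrite /= mE// probability_setT.
pose pM := Measure_isProbability.Build _ _ _ mu mu1.
pose p : probability (borel X) R := HB.pack m M pM.
have p_out (A : set (borel X)) : ~ measurable A -> p A = 0%E.
  by rewrite /= /m; case: pselect.
by exists (BProb p_out) => A /mE.
Qed.

HB.instance Definition _ (X : ptopologicalType) (R : realType) :=
  gen_eqMixin (bprob X R).
HB.instance Definition _ (X : ptopologicalType) (R : realType) :=
  gen_choiceMixin (bprob X R).

Definition contfun (X : ptopologicalType) (R : realType) : Type :=
  {f : X -> R | continuous f}.

HB.instance Definition _ (X : ptopologicalType) (R : realType) :=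
  gen_eqMixin (contfun X R).
HB.instance Definition _ (X : ptopologicalType) (R : realType) :=
  gen_choiceMixin (contfun X R).

Definition bprob_int (X : ptopologicalType) (R : realType) (mu : bprob X R) :
    {ptws contfun X R -> R} :=
  fun f => Rintegral mu [set: borel X] (sval f).

(* The weak-* topology: the coarsest one making mu |-> \int f dmu continuous for
   every continuous f. *)
HB.instance Definition _ (X : ptopologicalType) (R : realType) :=
  Topological.copy (bprob X R) (initial_topology (@bprob_int X R)).

Definition atomless (X : ptopologicalType) (R : realType) (mu : bprob X R) :=
  forall A : set (borel X), measurable A -> (0 < mu A)%E ->
    exists B : set (borel X),
      [/\ measurable B, B `<=` A & (0 < mu B < mu A)%E].

Definition full_support (X : ptopologicalType) (R : realType)
    (mu : bprob X R) :=
  forall U : set X, open U -> U !=set0 -> (0 < mu U)%E.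

Definition convex_bprob (X : ptopologicalType) (R : realType)
    (K : set (bprob X R)) :=
  forall (mu nu rho : bprob X R) (t : R), K mu -> K nu -> 0 <= t <= 1 ->
    (forall A : set (borel X), measurable A ->
       rho A = (t%:E * mu A + (1 - t)%:E * nu A)%E) ->
    K rho.

Record dynamical_simplex (X : ptopologicalType) (R : realType)
    (K : set (bprob X R)) : Prop := DynamicalSimplex {
  ds_nonempty : K !=set0 ;
  ds_compact : compact K ;
  ds_convex : convex_bprob K ;
  ds_atomless : forall mu, K mu -> atomless mu ;
  ds_full_support : forall mu, K mu -> full_support mu ;
  ds_subset : forall A B : set X, clopen A -> clopen B ->
    (forall mu, K mu -> (mu A < mu B)%E) ->
    exists A' : set X,
      [/\ clopen A', A' `<=` B & forall mu, K mu -> mu A' = mu A] }.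

Definition invariant_measure (X : ptopologicalType) (R : realType)
    (mu : bprob X R) (g : X -> X) : Prop :=
  forall A : set (borel X), measurable A ->
    pushforward mu (g : borel X -> borel X) A = mu A.

Record GK (X : ptopologicalType) (R : realType) (K : set (bprob X R)) := MkGK {
  GK_fun :> X -> X ;
  GK_homeo : homeomorphism GK_fun ;
  GK_inv : forall mu, K mu -> invariant_measure mu GK_fun }.

Definition clopen_partition (X : ptopologicalType) (P : set (set X)) : Prop :=
  [/\ finite_set P, partition P id [set: X] & forall A, P A -> clopen A].

(* The left coset g V, where V is the subgroup of all the h in G_K such that
   h(A) = A for every A in P. *)
Definition GK_coset (X : ptopologicalType) (R : realType)
    (K : set (bprob X R)) (g : GK K) (P : set (set X)) : set (GK K) :=
  [set h | forall A, P A -> h @` A = g @` A].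

Section GK_topology.
Variables (X : ptopologicalType) (R : realType) (K : set (bprob X R)).

HB.instance Definition _ := gen_eqMixin (GK K).
HB.instance Definition _ := gen_choiceMixin (GK K).
HB.instance Definition _ := hasNbhs.Build (GK K)
  (fun g => filter_from (@clopen_partition X) (GK_coset g)).

Let clopen_partitionT : clopen_partition [set [set: X]].
Proof.
split; first exact: finite_set1.
  split; first by rewrite /cover bigcup_set1.
    by move=> A B /= -> ->.
  by move=> A /= ->; exists point.
by move=> A /= ->; split; [exact: openT | exact: closedT].
Qed.

Let refine (P Q : set (set X)) : set (set X) :=
  [set C | (exists A B, [/\ P A, Q B & C = A `&` B]) /\ C !=set0].

Let clopen_partition_refine (P Q : set (set X)) :
  clopen_partition P -> clopen_partition Q -> clopen_partition (refine P Q).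
Proof.
move=> [fP [cP tP nP] oP] [fQ [cQ tQ nQ] oQ]; split.
- apply: (@sub_finite_set _ _ [set A `&` B | A in P & B in Q]).
    by move=> C [[A [B [PA QB ->]]] _]; exists A => //; exists B.
  exact: finite_image2.
- split.
  + apply/seteqP; split => // x _.
    have [A PA Ax] : cover P id x by rewrite cP.
    have [B QB Bx] : cover Q id x by rewrite cQ.
    exists (A `&` B) => //; split; last by exists x.
    by exists A, B.
  + move=> _ _ [[A [B [PA QB ->]]] _] [[A' [B' [PA' QB' ->]]] _].
    case=> x [[Ax Bx] [A'x B'x]].
    have <- : A = A' by apply: tP => //; exists x.
    by have <- : B = B' by apply: tQ => //; exists x.
  + by move=> C [].
- move=> _ [[A [B [/oP[oA cA] /oQ[oB cB] ->]]] _].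
  by split; [exact: openI | exact: closedI].
Qed.

Let image_refine (P Q : set (set X)) (g h : X -> X) :
  clopen_partition Q ->
  (forall C, refine P Q C -> h @` C = g @` C) ->
  forall A, P A -> h @` A = g @` A.
Proof.
move=> [_ [cQ _ _] _] hg A PA.
have sub (u v : X -> X) : (forall C, refine P Q C -> u @` C = v @` C) ->
    u @` A `<=` v @` A.
  move=> uv _ [x Ax <-].
  have [B QB Bx] : cover Q id x by rewrite cQ.
  have /uv E : refine P Q (A `&` B).
    by split; [exists A, B | exists x].
  have : (u @` (A `&` B)) (u x) by exists x.
  by rewrite E => -[y [Ay _] <-]; exists y.
apply/seteqP; split; first exact: sub.
by apply: sub => C /hg.
Qed.

Let GK_nbhs_filter (g : GK K) : ProperFilter (nbhs g).
Proof.
apply: filter_from_proper; last by move=> P _; exists g.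
apply: filter_from_filter; first by exists [set setT].
move=> P Q cP cQ; exists (refine P Q); first exact: clopen_partition_refine.
move=> h hg; split => A; first exact: image_refine hg _.
apply: (@image_refine Q P) => // C [[U [V [QU PV ->]]] n0].
by apply: hg; split => //; exists V, U; rewrite setIC.
Qed.

Let GK_nbhs_singleton (g : GK K) (S : set (GK K)) : nbhs g S -> S g.
Proof. by move=> [P _]; apply. Qed.

Let GK_nbhs_nbhs (g : GK K) (S : set (GK K)) :
  nbhs g S -> nbhs g (nbhs^~ S).
Proof.
move=> [P cP PS]; exists P => // h hg; exists P => // k kh; apply: PS => A PA.
by rewrite kh// hg.
Qed.

HB.instance Definition _ := Nbhs_isNbhsTopological.Build (GK K)
  GK_nbhs_filter GK_nbhs_singleton GK_nbhs_nbhs.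

End GK_topology.

(* As a type, GKstar K carries the library's subspace topology on set_type. *)
Definition GKstar (X : ptopologicalType) (R : realType) (K : set (bprob X R)) :
    set (GK K) :=
  [set g | forall U : set X, clopen U -> U !=set0 -> U <> [set: X] ->
     g @` U <> U].
Arguments GKstar {X R} K.

(* The atoms are the A i j with j <= n i; the values of A elsewhere are
   irrelevant. *)
Definition KR_index (I : finType) (n : I -> nat) : set (I * nat) :=
  [set p | (p.2 <= n p.1)%N].

Record KR_partition (X : ptopologicalType) (g : X -> X) (I : finType)
    (n : I -> nat) (A : I -> nat -> set X) : Prop := KRPartition {
  KR_part : partition (KR_index n) (fun p => A p.1 p.2) [set: X] ;
  KR_clopen : forall i j, (j <= n i)%N -> clopen (A i j) ;
  KR_step : forall i j, (j < n i)%N -> g @` A i j = A i j.+1 }.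

Definition union_of_atoms (X : ptopologicalType) (I : finType) (n : I -> nat)
    (A : I -> nat -> set X) (B : set X) : Prop :=
  exists2 D : set (I * nat), D `<=` KR_index n &
    B = \bigcup_(p in D) A p.1 p.2.

Definition atom_count (X : Type) (I : finType) (n : I -> nat)
    (A : I -> nat -> set X) (i : I) (B : set X) : nat :=
  #|[pred j : 'I_(n i).+1 | `[< A i j `<=` B >] ]|.

Definition saturated (X : ptopologicalType) (R : realType)
    (K : set (bprob X R)) (g : GK K) : Prop :=
  forall A B : set X, clopen A -> clopen B ->
    (forall mu, K mu -> mu A = mu B) ->
    exists (I : finType) (n : I -> nat) (C : I -> nat -> set X),
      [/\ KR_partition g n C,
          union_of_atoms n C A,
          union_of_atoms n C B
        & forall i, atom_count n C i A = atom_count n C i B ].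

(* Main.v *)
Require Import Defs.
From HB Require Import structures.
From mathcomp Require Import all_boot all_order all_algebra.
From mathcomp Require Import all_classical all_reals all_analysis.
From mathcomp Require Import zify ring lra.

Set Implicit Arguments.
Unset Strict Implicit.
Unset Printing Implicit Defensive.

Import Order.TTheory GRing.Theory Num.Theory.
Import numFieldNormedType.Exports.

Local Open Scope classical_set_scope.
Local Open Scope ring_scope.

(** Call value of a clopen set [A] the function [mu |-> mu A] on [K].  The
   defining property of a dynamical simplex allows one to subtract, inside a
   clopen set, a value that is smaller at every point of [K].  By full support a
   value is null or everywhere positive, so that values satisfy a Riesz
   decomposition property; as the measures are atomless and [K] is compact,
   every value is a sum of arbitrarily small ones.  The combinatorial part only
   uses these facts, collected in [riesz_scale] and proved for the simplex in
   [clopen_val_scale].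

   Saturation.  Fix clopen sets [A] and [B] of the same value.  Having a
   Kakutani-Rokhlin partition that is balanced for [A] and [B] is an open
   condition, since it only involves the images of finitely many clopen sets,
   and there are countably many pairs of clopen sets: it remains to approximate
   an element [g] of [G_K^*] by balanced ones.  Let [c, a] run over the cylinders
   of a large length.  The values of the sets [g(c) /\ a] form a circulation on
   the graph of cylinders, which is strongly connected because [g] fixes no
   nontrivial clopen set.  A circulation is a sum of closed walks; the Riesz
   property allows one to insert these in a walk through all the vertices, and
   then, since the excess of visits to [A] over visits to [B] has total value
   zero, to concatenate them into closed walks that visit [A] and [B] equally
   often ([balanced_walks]).  Cutting the sets [g(c) /\ a] into levels along
   these walks gives a partial isomorphism, defined on clopen sets, that agrees
   with [g] on cylinders ([columns_exist], [balanced_perturbation]).  No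
   nontrivial union of its atoms is sent to itself, and [linked_extension]
   extends such a partial isomorphism to an element of [G_K^*]: coordinates are
   added back and forth, and each time an atom is divided, the two pieces of its
   image are made to meet a common atom, which keeps the property at every stage
   and hence in the limit.

   Invariant measures.  Let [nu] be invariant under a saturated [g].  Counting
   levels in the columns of a Kakutani-Rokhlin partition shows that clopen sets
   of equal values have equal [nu]-masses ([saturated_mass]), so that [nu] acts
   on values.  If [nu] were not in [K], a function constant on cylinders would
   have a positive integral for all the elements of [K] and a negative one for
   [nu] ([simplex_separation]).  But the space can be stacked over a base of tiny
   value ([stacking]); dividing the sums of the function over the columns by a
   large constant turns the first inequality into a comparison of the values of
   two clopen sets, up to an error proportional to the base, and that comparison
   is inherited by [nu] ([state_pos]). *)


(** * Scales and systems of columns *)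

(** In the intended model [M] consists of the real functions on the simplex,
   [P x] says that [x] is zero or everywhere positive, [V x] that it is the value
   of a clopen set, and [u] is the value of the whole space. *)
Record riesz_scale (M : zmodType) (P V : M -> Prop) (u : M) : Prop := {
  rs_pos0 : P 0 ;
  rs_posD : forall x y, P x -> P y -> P (x + y) ;
  rs_pos_anti : forall x, P x -> P (- x) -> x = 0 ;
  rs_posV : forall x n, P (x *+ n.+1) -> P x ;
  rs_pos : forall x, V x -> P x ;
  rs_unit : V u ;
  rs_diff : forall x y, V x -> V y -> P (y - x) -> V (y - x) ;
  rs_riesz : forall x a b, V x -> V a -> V b -> V (a + b) -> V (a + b - x) ->
    exists y, [/\ V y, V (a - y), V (x - y) & V (b - (x - y))] ;
  rs_cut : forall x y, V x -> V y -> y != 0 ->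
    exists2 s : seq M, \sum_(z <- s) z = x &
      forall z, z \in s -> V z /\ V (y - z) ;
  rs_small : forall (s : seq M) n, (forall z, z \in s -> V z /\ z != 0) ->
    exists x, [/\ V x, x != 0 & forall z, z \in s -> P (z - x *+ n)] }.

Section Scale.
Variables (M : zmodType) (P V : M -> Prop) (u : M).
Hypothesis HV : riesz_scale P V u.

Lemma scale_posMn x n : P x -> P (x *+ n).
Proof.
move=> Px; elim: n => [|n IH]; first by rewrite mulr0n; exact: rs_pos0 HV.
by rewrite mulrS; exact: rs_posD HV _ _ Px IH.
Qed.

Lemma scale_pos_sum (I : eqType) (s : seq I) (p : pred I) (F : I -> M) :
  (forall i, i \in s -> p i -> P (F i)) -> P (\sum_(i <- s | p i) F i).
Proof.
move=> PF; rewrite big_seq_cond.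
apply: big_ind => [||i /andP[]]; [exact: rs_pos0 HV | exact: rs_posD HV |].
exact: PF.
Qed.

Lemma scale0 : V 0.
Proof.
have := rs_diff HV (rs_unit HV) (rs_unit HV); rewrite subrr; apply.
exact: rs_pos0 HV.
Qed.

Lemma scaleD x y : V x -> V y -> P (u - (x + y)) -> V (x + y).
Proof.
move=> Vx Vy Pxy.
have Vux : V (u - x).
  apply: (rs_diff HV Vx (rs_unit HV)).
  have -> : u - x = (u - (x + y)) + y by rewrite opprD addrA subrK.
  exact: rs_posD HV _ _ Pxy (rs_pos HV Vy).
have Vuxy : V (u - x - y) by apply: (rs_diff HV) => //; rewrite -addrA -opprD.
have -> : x + y = u - (u - x - y) by rewrite -addrA -opprD subKr.
apply: (rs_diff HV) => //; first exact: rs_unit HV.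
rewrite -addrA -opprD subKr.
exact: rs_posD HV _ _ (rs_pos HV Vx) (rs_pos HV Vy).
Qed.

Lemma scale_sum (I : eqType) (s : seq I) (p : pred I) (F : I -> M) :
    (forall i, i \in s -> p i -> V (F i)) ->
    P (u - \sum_(i <- s | p i) F i) ->
  V (\sum_(i <- s | p i) F i).
Proof.
elim: s => [|i s IH] VF; first by rewrite big_nil => _; exact: scale0.
have VF' j : j \in s -> p j -> V (F j).
  by move=> js; apply: VF; rewrite inE js orbT.
rewrite big_cons; case: ifP => [pi|_]; last by apply: IH.
have VFi : V (F i) by apply: VF => //; rewrite inE eqxx.
move=> Pu; apply: scaleD => //; apply: IH => //.
have := rs_posD HV Pu (rs_pos HV VFi).
by rewrite [F i + _]addrC opprD addrA subrK.
Qed.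

Lemma scaleMn x n : V x -> P (u - x *+ n) -> V (x *+ n).
Proof.
move=> Vx; have -> : x *+ n = \sum_(i <- iota 0 n) x.
  by rewrite big_const_seq count_predT size_iota iter_addr_0.
by move=> Pu; apply: scale_sum.
Qed.

(** ** Splitting and attaching columns *)

Section Systems.
Variables (E : finType) (T : eqType) (cnt : T -> E -> nat) (m : E -> M).
Hypothesis sum_m : \sum_e m e = u.
Implicit Types (S I N : seq (M * T)) (t : T).

Definition wsize t := (\sum_e cnt t e)%N.

(** The value [x.1] of a column [x] is the common size of its levels; its word
   [x.2] lists the letters in which they lie.  The levels of all columns share
   out the size [m e] of each letter [e]. *)
Definition column_system S :=
  (forall x, x \in S -> V x.1 /\ (0 < wsize x.2)%N) /\
  (forall e, \sum_(x <- S) x.1 *+ cnt x.2 e = m e).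

Lemma perm_column_system S S' :
  perm_eq S S' -> column_system S -> column_system S'.
Proof.
move=> SS' [VS cS]; split; first by move=> x xS; apply: VS;
  rewrite (perm_mem SS').
by move=> e; rewrite -(perm_big _ SS').
Qed.

Lemma column_system_unit S : column_system S ->
  \sum_(x <- S) x.1 *+ wsize x.2 = u.
Proof.
move=> [_ cS]; rewrite -sum_m -(eq_bigr _ (fun e _ => cS e)) exchange_big /=.
by apply: eq_bigr => x _; rewrite -sumrMnr.
Qed.

Lemma column_system_part I N (k : T -> nat) :
    column_system (I ++ N) -> (forall x, x \in I -> (k x.2 <= wsize x.2)%N) ->
  V (\sum_(x <- I) x.1 *+ k x.2).
Proof.
move=> hS hk; have [VS _] := hS.
have VI x : x \in I -> V x.1 by move=> xI; case: (VS x); rewrite ?mem_cat ?xI.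
have key x j : x \in I ++ N -> P (x.1 *+ j).
  by move=> /VS[/(rs_pos HV)]; move/scale_posMn.
have Pu : P (u - \sum_(x <- I) x.1 *+ k x.2).
  rewrite -(column_system_unit hS) big_cat /= addrAC -sumrB.
  apply: (rs_posD HV); apply: scale_pos_sum => x xS _; last first.
    by apply: key; rewrite mem_cat xS orbT.
  by rewrite -mulrnBr ?hk//; apply: key; rewrite mem_cat xS.
apply: (scale_sum _ Pu) => x xI _; apply: scaleMn; first exact: VI.
have -> : u - x.1 *+ k x.2 =
    u - \sum_(y <- I) y.1 *+ k y.2 + \sum_(y <- rem x I) y.1 *+ k y.2.
  by rewrite (perm_big _ (perm_to_rem xI)) big_cons /= opprD addrA subrK.
apply: (rs_posD HV) => //.
by apply: scale_pos_sum => y /mem_rem yS _; apply: key; rewrite mem_cat yS.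
Qed.

Lemma column_system_sum I N : column_system (I ++ N) -> V (\sum_(x <- I) x.1).
Proof.
move=> hS; have [VS _] := hS.
under eq_bigr do rewrite -(mulr1n _.1).
apply: (@column_system_part _ N (fun=> 1%N)) => // x xI.
by have [] := VS x; rewrite ?mem_cat ?xI.
Qed.

Lemma split_below (I : seq (M * T)) x :
    (forall y, y \in I -> V y.1) -> V (\sum_(y <- I) y.1) ->
    V x -> V (\sum_(y <- I) y.1 - x) ->
  exists s : seq (M * M * T),
    [/\ [seq (y.1.1 + y.1.2, y.2) | y <- s] = I,
        (forall y, y \in s -> V y.1.1 /\ V y.1.2) &
        \sum_(y <- s) y.1.1 = x].
Proof.
elim: I x => [|[a t] I IH] x VI.
  rewrite big_nil sub0r => _ Vx VNx; exists [::]; split => //.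
  by rewrite big_nil (rs_pos_anti HV (rs_pos HV Vx) (rs_pos HV VNx)).
rewrite !big_cons /= => Vab Vx Vabx.
have Va : V a by apply: (VI (a, t)); rewrite inE eqxx.
have VI' y : y \in I -> V y.1 by move=> yI; apply: VI; rewrite inE yI orbT.
have Vb : V (\sum_(y <- I) y.1).
  rewrite -[X in V X](addKr a) addrC; apply: (rs_diff HV) => //.
  by rewrite addrC addKr; apply: scale_pos_sum => y /VI' + _;
    exact: (rs_pos HV).
have [y [Vy Vay Vxy Vbxy]] := rs_riesz HV Vx Va Vb Vab Vabx.
have [s [sI Vs sx]] := IH _ VI' Vb Vxy Vbxy.
exists ((y, a - y, t) :: s); split => /=.
- by rewrite sI addrC subrK.
- by move=> z; rewrite inE => /orP[/eqP ->//|/Vs].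
- by rewrite big_cons /= sx addrC subrK.
Qed.

(** Every construction on columns is a succession of this move: a column is cut
   up, and its pieces are put on top of pieces of other columns, or inside them,
   [ins] being the resulting operation on words.  The Riesz property provides
   the pieces, and the total size of each letter is unchanged. *)
Lemma column_system_splice x t I N (ins : T -> T) :
    column_system ((x, t) :: I ++ N) ->
    (forall y e, y \in I -> cnt (ins y.2) e = (cnt y.2 e + cnt t e)%N) ->
    P (\sum_(y <- I) y.1 - x) ->
  exists s : seq (M * M * T),
    [/\ [seq (y.1.1 + y.1.2, y.2) | y <- s] = I,
        \sum_(y <- s) y.1.1 = x &
        column_system ([seq (y.1.1, ins y.2) | y <- s] ++
                       [seq (y.1.2, y.2) | y <- s] ++ N)].
Proof.
move=> hS hins Px; have [VS cS] := hS.
have Vx : V x by have [] := VS (x, t); rewrite ?inE ?eqxx.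
have VI y : y \in I -> V y.1 /\ (0 < wsize y.2)%N.
  by move=> yI; apply: VS; rewrite inE mem_cat yI /= orbT.
have VsI : V (\sum_(y <- I) y.1).
  apply: (@column_system_sum _ ((x, t) :: N)); apply: perm_column_system hS.
  by rewrite -cat1s perm_catCA.
have Vsx := rs_diff HV Vx VsI Px.
have [s [sI Vs sx]] := split_below (fun y yI => (VI y yI).1) VsI Vx Vsx.
have sI2 y : y \in s -> (y.1.1 + y.1.2, y.2) \in I.
  by move=> ys; rewrite -sI; apply: map_f ys.
exists s; split => //; split.
  move=> y; rewrite !mem_cat => /or3P[/mapP[z zs ->]|/mapP[z zs ->]|yN] /=.
  - split; first by case: (Vs z zs).
    rewrite /wsize; under eq_bigr => e _ do rewrite (hins _ _ (sI2 z zs)).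
    by rewrite big_split /= addn_gt0 (VI _ (sI2 z zs)).2.
  - by split; [case: (Vs z zs) | exact: (VI _ (sI2 z zs)).2].
  - by apply: VS; rewrite inE mem_cat yN !orbT.
move=> e; rewrite -cS big_cons !big_cat !big_map /= addrA -big_split /=.
rewrite [in RHS]addrA; congr (_ + _).
rewrite -{1}sI big_map /= -sx -sumrMnl -big_split /=.
rewrite [LHS]big_seq [RHS]big_seq; apply: eq_bigr => y ys.
by rewrite (hins _ _ (sI2 y ys)) mulrnDr mulrnDl addrAC addrC addrA.
Qed.

Lemma column_system_nonzero S : column_system S ->
  column_system [seq x <- S | x.1 != 0].
Proof.
move=> [VS cS]; split; first by move=> x; rewrite mem_filter => /andP[_ /VS].
move=> e; rewrite -cS big_filter big_mkcond; apply: eq_bigr => x _.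
by case: eqVneq => //= ->; rewrite mul0rn.
Qed.

Lemma column_system_cut (B : T -> Prop) z L N : V z -> z != 0 ->
    column_system (L ++ N) -> (forall x, x \in L -> B x.2) ->
  exists2 L' : seq (M * T), column_system (L' ++ N) &
    forall x, x \in L' -> B x.2 /\ P (z - x.1).
Proof.
move=> Vz z0; elim: L N => [|[x t] L IH] N hS BL; first by exists [::].
have hS' : column_system (L ++ (x, t) :: N).
  by apply: perm_column_system hS;
    rewrite perm_sym perm_catC /= perm_cons perm_catC.
have [|L' hL' BL'] := IH _ hS'; first by move=> y yL; apply: BL;
  rewrite inE yL orbT.
have [VL cL] := hL'.
have xL : (x, t) \in L' ++ (x, t) :: N by rewrite mem_cat !inE eqxx orbT.
have [s /= sx Vs] := rs_cut HV (VL _ xL).1 Vz z0.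
exists ([seq (y, t) | y <- s] ++ L'); last first.
  move=> y; rewrite mem_cat => /orP[/mapP[v vs ->]|/BL'//] /=.
  by split; [apply: (BL (x, t)); rewrite inE eqxx | apply: (rs_pos HV);
    case: (Vs v vs)].
split.
  move=> y; rewrite !mem_cat -orbA => /or3P[/mapP[v vs ->]|yL|yN] /=.
  - by split; [case: (Vs v vs) | exact: (VL _ xL).2].
  - by apply: VL; rewrite mem_cat yL.
  - by apply: VL; rewrite mem_cat inE yN !orbT.
move=> e; rewrite -cL !big_cat big_cons big_map /= -sx -sumrMnl.
by rewrite [LHS]addrAC addrC addrA.
Qed.

(** Columns of tiny total size can absorb all the others: these are cut into
   pieces smaller than that size, which are inserted one at a time and leave the
   total size of the absorbing columns unchanged. *)
Lemma column_system_absorb (A B : T -> Prop) (ins : T -> T -> T) Mk L :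
    (forall a b, A a -> B b -> A (ins a b) /\
       forall e, cnt (ins a b) e = (cnt a e + cnt b e)%N) ->
    column_system (Mk ++ L) -> (forall x, x \in Mk -> A x.2) ->
    (forall x, x \in L -> B x.2) -> \sum_(x <- Mk) x.1 != 0 ->
  exists S, [/\ column_system S, forall x, x \in S -> A x.2 &
                \sum_(x <- S) x.1 = \sum_(x <- Mk) x.1].
Proof.
move=> hins hS AM BL z0.
have hLM : column_system (L ++ Mk).
  by apply: perm_column_system hS; rewrite perm_catC.
have [L' hL' {}BL] := column_system_cut (column_system_sum hS) z0 hLM BL.
elim: L' Mk {hS hLM z0} AM hL' BL => [|[x t] L' IH] Mk AM hS BL.
  by exists Mk.
have BL' y : y \in L' -> B y.2 /\ P (\sum_(x <- Mk) x.1 - y.1).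
  by move=> yL; apply: BL; rewrite inE yL orbT.
have [Bt Px] : B t /\ P (\sum_(x <- Mk) x.1 - x).
  by apply: (BL (x, t)); rewrite inE eqxx.
have hS' : column_system ((x, t) :: Mk ++ L').
  by apply: perm_column_system hS; rewrite /= perm_cons perm_catC.
have hi y e : y \in Mk -> cnt (ins y.2 t) e = (cnt y.2 e + cnt t e)%N.
  by move=> yM; have [_ ->] := hins _ _ (AM _ yM) Bt.
have [s [sM sx hs]] := column_system_splice (ins := ins^~ t) hS' hi Px.
pose Mk' := [seq (y.1.1, ins y.2 t) | y <- s] ++ [seq (y.1.2, y.2) | y <- s].
have sumM : \sum_(x <- Mk') x.1 = \sum_(x <- Mk) x.1.
  by rewrite -sM big_cat !big_map /= -big_split.
rewrite -sumM; apply: IH.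
- have As y : y \in s -> A y.2.
    by move=> ys; apply: (AM (y.1.1 + y.1.2, y.2)); rewrite -sM;
      apply: map_f ys.
  move=> y; rewrite mem_cat => /orP[] /mapP[v /As Av ->] //=.
  by have [] := hins _ _ Av Bt.
- by apply: perm_column_system hs; rewrite catA perm_catC.
- by move=> y; rewrite sumM; exact: BL'.
Qed.

(** ** Balancing integer weights *)

Definition weight (w : E -> int) t : int := \sum_e w e *+ cnt t e.

Lemma column_system_weight (w : E -> int) S : column_system S ->
  \sum_(x <- S) x.1 *~ weight w x.2 = \sum_e m e *~ w e.
Proof.
move=> [_ cS]; under [RHS]eq_bigr do rewrite -cS mulrz_suml.
rewrite exchange_big /=; apply: eq_bigr => x _.
rewrite /weight mulrz_sumr; apply: eq_bigr => e _.
by rewrite -[w e *+ _]mulr_natl mulrzA mulrz_nat.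
Qed.

Lemma weightN (w : E -> int) t : weight (fun e => - w e) t = - weight w t.
Proof. by rewrite -sumrN; apply: eq_bigr => e _; rewrite mulNrn. Qed.

Section Balance.
Variables (A : T -> Prop) (ins : T -> T -> T).
Hypothesis insA : forall a b, A a -> A b -> A (ins a b).
Hypothesis ins_cnt : forall a b, A a -> A b ->
  forall e, cnt (ins a b) e = (cnt a e + cnt b e)%N.

Lemma weight_ins w a b : A a -> A b ->
  weight w (ins a b) = weight w a + weight w b.
Proof.
move=> Aa Ab; rewrite -big_split; apply: eq_bigr => e _.
by rewrite ins_cnt // mulrnDr.
Qed.

Let heavy w D (x : M * T) := `|weight w x.2|%N == D.+1.

(** A column [x] of maximal weight is attached to columns of negative weight.
   These are large enough: maximality of the weight of [x] and the vanishing of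
   the total weight give [D.+1 * x <= D.+1 * (negative columns)].  The new
   columns are lighter, and [x] is gone. *)
Lemma column_system_lighten w D S x :
    \sum_e m e *~ w e = 0 -> column_system S ->
    (forall y, y \in S -> A y.2 /\ (`|weight w y.2| <= D.+1)%N) ->
    x \in S -> weight w x.2 = D.+1%:Z ->
  exists S', [/\ column_system S',
    forall y, y \in S' -> A y.2 /\ (`|weight w y.2| <= D.+1)%N &
    (count (heavy w D) S' < count (heavy w D) S)%N].
Proof.
move=> w0 hS AS xS wx.
pose neg := fun y : M * T => weight w y.2 < 0.
pose I := [seq y <- rem x S | neg y];
  pose N := [seq y <- rem x S | predC neg y].
have pS : perm_eq S (x :: (I ++ N)).
  apply: perm_trans (perm_to_rem xS) _.
  by rewrite perm_cons perm_sym; exact/permPl/perm_filterC.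
have hS' := perm_column_system pS hS.
have AS' y : y \in x :: (I ++ N) -> A y.2 /\ (`|weight w y.2| <= D.+1)%N.
  by rewrite -(perm_mem pS); exact: AS.
have I_neg y : y \in I -> weight w y.2 < 0 by rewrite mem_filter => /andP[].
have N_pos y : y \in N -> 0 <= weight w y.2.
  by rewrite mem_filter => /andP[/=]; rewrite -leNgt.
have AI y : y \in I -> A y.2 /\ (`|weight w y.2| <= D.+1)%N.
  by move=> yI; apply: AS'; rewrite inE mem_cat yI orbT.
have AN y : y \in N -> A y.2 /\ (`|weight w y.2| <= D.+1)%N.
  by move=> yN; apply: AS'; rewrite inE mem_cat yN !orbT.
have [Ax _] : A x.2 /\ (`|weight w x.2| <= D.+1)%N.
  by apply: AS'; rewrite inE eqxx.
have PN y k : y \in x :: (I ++ N) -> P (y.1 *+ k).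
  by move=> /hS'.1[Vy _]; exact: scale_posMn (rs_pos HV Vy).
have Px : P (\sum_(y <- I) y.1 - x.1).
  apply: (rs_posV HV (n := D)).
  have := column_system_weight w hS'; rewrite w0 big_cons big_cat /= wx => tot.
  have -> : (\sum_(y <- I) y.1 - x.1) *+ D.+1 =
      \sum_(y <- I) y.1 *+ (D.+1 - `|weight w y.2|)%N +
      \sum_(y <- N) y.1 *+ `|weight w y.2|%N.
    rewrite mulrnBl -sumrMnl.
    have -> : \sum_(y <- I) y.1 *+ (D.+1 - `|weight w y.2|)%N =
        \sum_(y <- I) y.1 *+ D.+1 + \sum_(y <- I) y.1 *~ weight w y.2.
      rewrite -big_split [LHS]big_seq [RHS]big_seq; apply: eq_bigr => y yI /=.
      have [_ le] := AI _ yI; rewrite mulrnBr //.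
      have {2}-> : weight w y.2 = - `|weight w y.2|%N%:Z.
        by have := I_neg _ yI; lia.
      by rewrite mulrNz.
    have -> : \sum_(y <- N) y.1 *+ `|weight w y.2|%N =
        \sum_(y <- N) y.1 *~ weight w y.2.
      rewrite [LHS]big_seq [RHS]big_seq; apply: eq_bigr => y yN /=.
      have {2}-> // : weight w y.2 = `|weight w y.2|%N%:Z.
      by have := N_pos _ yN; lia.
    rewrite -addrA; congr (_ + _); apply/esym/eqP.
    by rewrite -addr_eq0 [_ + x.1 *+ _]addrC pmulrn tot.
  apply: (rs_posD HV); apply: scale_pos_sum => y yS _; apply: PN.
    by rewrite inE mem_cat yS orbT.
  by rewrite inE mem_cat yS !orbT.
rewrite (surjective_pairing x) in hS'.
have hi y e : y \in I -> cnt (ins y.2 x.2) e = (cnt y.2 e + cnt x.2 e)%N.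
  by move=> yI; rewrite ins_cnt //; case: (AI _ yI).
have [s [sI sx hs]] := column_system_splice (ins := ins^~ x.2) hS' hi Px.
have sI2 y : y \in s -> (y.1.1 + y.1.2, y.2) \in I.
  by move=> ys; rewrite -sI; apply: map_f ys.
exists ([seq (y.1.1, ins y.2 x.2) | y <- s] ++ [seq (y.1.2,
  y.2) | y <- s] ++ N).
have wJ y : y \in s -> weight w (ins y.2 x.2) = weight w y.2 + D.+1%:Z /\
    - D.+1%:Z <= weight w y.2 < 0.
  move=> /sI2 yI; have [Ay le] := AI _ yI; have lt := I_neg _ yI.
  rewrite weight_ins // wx; split => //; move: le lt => /=; lia.
split => //.
  move=> y; rewrite !mem_cat => /or3P[/mapP[z zs ->]|/mapP[z zs ->]|/AN//] /=.
  - have [-> ?] := wJ _ zs; split; last lia.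
    by apply: insA => //; have [] := AI _ (sI2 _ zs).
  - exact: (AI _ (sI2 _ zs)).
have /permP -> := pS.
rewrite /= !count_cat -{1}sI !count_map /heavy /= wx eqxx add1n ltnS.
rewrite -[leqRHS]add0n leq_add2r leqn0 eqn0Ngt -has_count;
  apply/hasPn => y ys /=.
by have [-> ?] := wJ _ ys; lia.
Qed.

(** Induction on the largest absolute weight, and for a given one on the number
   of columns attaining it; up to a change of sign of the weights, such a column
   can be attached to others by the previous lemma. *)
Lemma column_system_balance w S :
    \sum_e m e *~ w e = 0 -> column_system S -> (forall y, y \in S -> A y.2) ->
  exists S', column_system S' /\
    forall y, y \in S' -> A y.2 /\ weight w y.2 = 0.
Proof.
move=> w0 hS AS.
have {AS} : forall y, y \in S -> A y.2 /\
    (`|weight w y.2| <= \max_(x <- S) `|weight w x.2|)%N.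
  by move=> y yS; split; [exact: AS | exact: (leq_bigmax_seq (F := fun x =>
    `|weight w x.2|%N))].
move: (\max_(x <- S) _)%N => D; elim: D S hS => [|D IH] S hS AS.
  by exists S; split => // y /AS[Ay]; rewrite leqn0 absz_eq0 => /eqP.
have [k] := ubnP (count (heavy w D) S).
elim: k S hS AS => // k IHk S hS AS; rewrite ltnS => cS.
have [|/hasPn light] := boolP (has (heavy w D) S); last first.
  apply: IH hS _ => y yS; have [Ay le] := AS _ yS; split => //.
  by rewrite -ltnS ltn_neqAle le andbT; exact: light.
case/hasP => x xS /eqP wx.
have [S' [hS' AS' lt]] : exists S', [/\ column_system S',
    forall y, y \in S' -> A y.2 /\ (`|weight w y.2| <= D.+1)%N &
    (count (heavy w D) S' < count (heavy w D) S)%N].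
  have [w_pos|w_neg] : weight w x.2 = D.+1%:Z \/ weight w x.2 = - D.+1%:Z.
    by move: wx; case: (weight w x.2) => n /= <-; [left | right; rewrite NegzE].
    exact: column_system_lighten xS w_pos.
  pose w' e := - w e.
  have w'0 : \sum_e m e *~ w' e = 0.
    by under eq_bigr do rewrite mulrNz; rewrite sumrN w0 oppr0.
  have w'x : weight w' x.2 = D.+1%:Z by rewrite weightN w_neg opprK.
  have AS' y : y \in S -> A y.2 /\ (`|weight w' y.2| <= D.+1)%N.
    by rewrite weightN abszN; exact: AS.
  have [S' [hS' AS'' lt]] := column_system_lighten w'0 hS AS' xS w'x.
  have heavyN y : heavy w' D y = heavy w D y by rewrite /heavy weightN abszN.
  exists S'; split => //; first by move=> y; move: (AS'' y);
    rewrite weightN abszN.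
  by rewrite -2!(eq_count heavyN).
by apply: IHk hS' AS' _; exact: leq_trans lt cS.
Qed.
End Balance.
End Systems.

(** ** Closed walks *)

Section Walks.
Variables (W : finType) (m : W * W -> M).
Hypotheses (m_V : forall e, V (m e)) (sum_m : \sum_e m e = u).
Hypothesis m_flow : forall v, \sum_a m (v, a) = \sum_c m (c, v).

(** A walk [(c, w)] starts at the vertex [c] and then visits the vertices of
   [w]; its letters are its steps. *)
Definition steps (t : W * seq W) := pairmap pair t.1 t.2.
Definition step_count (t : W * seq W) (e : W * W) := count_mem e (steps t).
Definition closed_walk (t : W * seq W) := last t.1 t.2 == t.1.
Local Notation walk_system := (column_system step_count m).

Lemma wsize_walk t : wsize step_count t = size t.2.
Proof.
rewrite -(size_pairmap pair t.1 t.2) -sum1_size /wsize.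
rewrite [LHS](eq_bigr (fun e => \sum_(f <- steps t | f == e) 1)%N); last first.
  by move=> e _; rewrite /step_count -sum1_count.
rewrite (exchange_big_dep predT) //=; apply: eq_bigr => f _.
by rewrite (big_pred1 f) // => e; rewrite eq_sym.
Qed.

Lemma step_count_cat c x w e : step_count (c, x ++ w) e =
  (step_count (c, x) e + step_count (last c x, w) e)%N.
Proof. by rewrite /step_count /steps /= pairmap_cat count_cat. Qed.

Lemma walk_flow (t : W * seq W) v :
  ((t.1 == v) + \sum_c step_count t (c, v) =
   (last t.1 t.2 == v) + \sum_a step_count t (v, a))%N.
Proof.
case: t => c w; rewrite /step_count /steps /=.
elim: w c => [|y w IH] c /=; first by rewrite !big1.
rewrite !big_split /= [in RHS]addnCA -IH; congr (_ + (_ + _))%N.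
  rewrite (bigD1 y) //= xpair_eqE eqxx andbT big1 ?addn0 // => a ay.
  by rewrite xpair_eqE andbC eq_sym (negPf ay).
rewrite (bigD1 c) //= xpair_eqE eqxx /= big1 ?addn0 // => a ac.
by rewrite xpair_eqE eq_sym (negPf ac).
Qed.

Lemma walk_system_flow S N v : walk_system (S ++ N) ->
    (forall x, x \in N -> closed_walk x.2) ->
  \sum_(x <- S | ~~ closed_walk x.2 && (x.2.1 == v)) x.1 =
  \sum_(x <- S | ~~ closed_walk x.2 && (last x.2.1 x.2.2 == v)) x.1.
Proof.
move=> [_ +] N_closed; set SN := S ++ N => cS.
have open_part (p : pred (M * (W * seq W))) :
    \sum_(x <- S | ~~ closed_walk x.2 && p x) x.1 =
    \sum_(x <- SN | ~~ closed_walk x.2 && p x) x.1.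
  rewrite big_cat /= [X in _ + X]big_seq_cond [X in _ + X]big1 ?addr0 // => x.
  by case/andP => /N_closed ->.
rewrite !open_part => {open_part}; move: SN cS => {N_closed N}{}S cS.
have key : \sum_(x <- S) x.1 *+ (x.2.1 == v) =
    \sum_(x <- S) x.1 *+ (last x.2.1 x.2.2 == v).
  apply: (addIr (\sum_c m (c, v))); rewrite -[in RHS]m_flow.
  have flow_out (f : W -> W * W) : \sum_a m (f a) =
      \sum_(x <- S) x.1 *+ (\sum_a step_count x.2 (f a))%N.
    rewrite (eq_bigr _ (fun a _ => esym (cS (f a)))) exchange_big /=.
    by apply: eq_bigr => x _; rewrite -sumrMnr.
  rewrite !flow_out -!big_split /=; apply: eq_bigr => x _.
  by rewrite -!mulrnDr walk_flow.
pose loops (f : W * seq W -> W) :=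
  \sum_(x <- S | closed_walk x.2) x.1 *+ (f x.2 == v).
have split_loops f : \sum_(x <- S) x.1 *+ (f x.2 == v) =
    loops f + \sum_(x <- S | ~~ closed_walk x.2 && (f x.2 == v)) x.1.
  rewrite (bigID (fun x => closed_walk x.2)) /=; congr (_ + _).
  rewrite [RHS]big_mkcondr; apply: eq_bigr => x _.
  by case: eqP; rewrite ?mulr1n ?mulr0n.
apply: (addrI (loops fst)); rewrite -(split_loops fst) key.
rewrite (split_loops (fun t => last t.1 t.2)); congr (_ + _).
by apply: eq_bigr => x /eqP ->.
Qed.

(** A circulation is a sum of closed walks.  The vertices are dealt with one by
   one: each open walk starting at [v] is put on top of pieces of the open walks
   ending at [v], which are large enough by conservation of the flow; once no
   open walk starts at [v], conservation shows that none ends there. *)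
Lemma walk_system_loops S L : walk_system (S ++ L) ->
    (forall x, x \in L -> closed_walk x.2) ->
  exists S', walk_system (S' ++ L) /\ forall x, x \in S' -> closed_walk x.2.
Proof.
move=> hS L_closed.
have : forall x, x \in S -> closed_walk x.2 ||
    ((x.2.1 \in enum W) && (last x.2.1 x.2.2 \in enum W)).
  by move=> x _; rewrite !mem_enum orbT.
elim: (enum W) S hS => [|v vs IH] S hS vS.
  by exists S; split => // x /vS; rewrite orbF.
pose out (x : M * (W * seq W)) := ~~ closed_walk x.2 && (x.2.1 == v).
pose into (x : M * (W * seq W)) :=
  ~~ closed_walk x.2 && (last x.2.1 x.2.2 == v).
have [k] := ubnP (count out S).
elim: k S hS vS => // k IHk S hS vS; rewrite ltnS => cS.
have [|/hasPn no_out] := boolP (has out S).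
  case/hasP => x xS /andP[x_open /eqP xv].
  pose I := [seq y <- rem x S | into y];
    pose N := [seq y <- rem x S | predC into y].
  have pS : perm_eq S (x :: (I ++ N)).
    apply: perm_trans (perm_to_rem xS) _.
    by rewrite perm_cons perm_sym; exact/permPl/perm_filterC.
  have hS' : walk_system (x :: (I ++ (N ++ L))).
    by apply: perm_column_system hS; rewrite -cat_cons catA perm_cat2r.
  have stop_x : last x.2.1 x.2.2 != v by apply: contraNneq x_open;
    rewrite /closed_walk xv => ->.
  have Px : P (\sum_(y <- I) y.1 - x.1).
    rewrite big_filter.
    have := walk_system_flow v hS L_closed.
    rewrite !(perm_big _ (perm_to_rem xS)) !big_cons x_open (negPf stop_x) xv
      eqxx /=.
    rewrite /into => <-; rewrite addrAC subrr add0r;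
      apply: scale_pos_sum => y yS _.
    by apply: (rs_pos HV); have [] := hS.1 y; rewrite ?mem_cat ?(mem_rem yS).
  rewrite (surjective_pairing x) in hS'.
  have intoI y : y \in I -> into y by rewrite mem_filter => /andP[].
  pose ins (t : W * seq W) := (t.1, t.2 ++ x.2.2).
  have hi y e : y \in I -> step_count (ins y.2) e = (step_count y.2 e +
    step_count x.2 e)%N.
    move=> /intoI /andP[_ /eqP yv]; rewrite (surjective_pairing y.2) /ins /=.
    by rewrite step_count_cat yv -xv.
  have [s [sI sx hs]] := column_system_splice (ins := ins) sum_m hS' hi Px.
  have sI2 y : y \in s -> (y.1.1 + y.1.2, y.2) \in I.
    by move=> ys; rewrite -sI; apply: map_f ys.
  have sub_vs y : y \in I ++ N -> closed_walk y.2 ||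
      ((y.2.1 \in v :: vs) && (last y.2.1 y.2.2 \in v :: vs)).
    by move=> yIN; apply: vS; rewrite (perm_mem pS) inE yIN orbT.
  have s_start y : y \in s -> [/\ ~~ closed_walk y.2, y.2.1 != v,
      last y.2.1 y.2.2 = v & y.2.1 \in v :: vs].
    move=> /sI2 yI; have /andP[/= y_open /eqP yv] := intoI _ yI.
    split => //; first by rewrite -yv eq_sym.
    by have := sub_vs (y.1.1 + y.1.2, y.2);
      rewrite mem_cat yI /= (negPf y_open) => /(_ isT)/andP[].
  move: hs; rewrite 2!catA -(catA _ _ N) => hs.
  apply: IHk hs _ _.
    move=> y; rewrite !mem_cat => /or3P[/mapP[z zs ->]|/mapP[z zs ->]|yN] /=.
    - have [_ _ zv zvs] := s_start _ zs; apply/orP; right.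
      rewrite zvs last_cat zv.
      by have := vS _ xS; rewrite (negPf x_open) !xv => /andP[].
    - by apply: (sub_vs (z.1.1 + z.1.2, z.2)); rewrite mem_cat sI2.
    - by apply: sub_vs; rewrite mem_cat yN orbT.
  apply: leq_trans cS; have /permP -> := pS.
  have out_x : out x by rewrite /out x_open xv eqxx.
  rewrite /= out_x add1n ltnS !count_cat.
  have no_out_s (f : M * M * (W * seq W) -> M * (W * seq W)) :
      (forall y, (f y).2.1 = y.2.1) -> count out [seq f y | y <- s] = 0%N.
    move=> fE; apply/eqP; rewrite eqn0Ngt -has_count.
    apply/hasPn => _ /mapP[y ys ->]; have [_ yv _ _] := s_start _ ys.
    by rewrite /out negb_and fE yv orbT.
  by rewrite !no_out_s // leq_addl.
have hS0 : walk_system ([seq y <- S | y.1 != 0] ++ L).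
  split; first by move=> x; rewrite mem_cat mem_filter => xSL; apply: hS.1;
    move: xSL;
    rewrite mem_cat => /orP[/andP[_ ->]|->]; rewrite ?orbT.
  move=> e; rewrite -hS.2 !big_cat big_filter big_mkcond /=; congr (_ + _).
  by apply: eq_bigr => x _; case: eqVneq => //= ->; rewrite mul0rn.
apply: IH hS0 _ => x.
have no_into y : y \in [seq y <- S | y.1 != 0] -> ~~ into y.
  rewrite mem_filter => /andP[y0 yS]; apply: contra y0 => vy.
  have : \sum_(z <- S | into z) z.1 = 0.
    rewrite -[LHS](walk_system_flow v hS L_closed) big_seq_cond big1 // =>
      z /andP[zS].
    by have := no_out _ zS; rewrite /out => /negPf ->.
  have yVP z : z \in S -> P z.1 by move=> zS; apply: (rs_pos HV);
    have [] := hS.1 z; rewrite ?mem_cat ?zS.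
  rewrite (perm_big _ (perm_to_rem yS)) big_cons vy /= => /eqP.
  rewrite addrC addr_eq0 => /eqP sum_y; apply/eqP/(rs_pos_anti HV);
    first exact: yVP.
  by rewrite -sum_y; apply: scale_pos_sum => z /mem_rem /yVP.
move=> xS; have := no_into _ xS; move: xS; rewrite mem_filter => /andP[_ xS].
have := no_out _ xS; have := vS _ xS; rewrite /out /into !inE.
by case: (closed_walk _) => //=; do 2 case: eqP => //=.
Qed.

Hypothesis m_connect : forall a b, connect (fun c d => m (c, d) != 0) a b.
Hypothesis u_neq0 : u != 0.

Lemma tour_exists a0 : exists w, [/\ w != [::], last a0 w = a0,
  forall v, v \in w & forall e, e \in steps (a0, w) -> m e != 0].
Proof.
pose r c d := m (c, d) != 0.
suff [w [w0 wa wv rw]] : exists w, [/\ w != [::], last a0 w = a0,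
    {subset enum W <= w} & path r a0 w].
  exists w; split => // [v|e]; first by apply: wv; rewrite mem_enum.
  rewrite /steps /=; elim: w a0 {w0 wa wv} rw => //= y w IH c /andP[cy yw].
  by rewrite inE => /orP[/eqP ->//|]; exact: IH.
have go a b := @connectP _ r a b (m_connect a b).
elim: (enum W) => [|v vs [w [w0 wa wv rw]]].
  have [e e0] : exists e, m e != 0.
    apply/existsP; apply: contraNT u_neq0; rewrite negb_exists => /forallP m0.
    by rewrite -sum_m big1 // => e _; apply/eqP; rewrite -[_ == _]negbK.
  have [p pe ep] := go a0 e.1; have [q qe eq] := go e.2 a0.
  exists (p ++ e.2 :: q); split => //; first by case: (p).
    by rewrite last_cat.
  by rewrite cat_path pe -ep /= qe andbT /r -surjective_pairing.
have [p pv ep] := go a0 v; have [q qv eq] := go v a0.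
exists (p ++ q ++ w); split.
- by rewrite -size_eq0 !size_cat !addn_eq0 !size_eq0 (negPf w0) !andbF.
- by rewrite !last_cat -ep -eq.
- move=> y; rewrite inE => /orP[/eqP ->|/wv yw];
  last by rewrite !mem_cat yw !orbT.
  have : v \in a0 :: p by rewrite {1}ep mem_last.
  rewrite inE !mem_cat => /orP[/eqP ->|->//].
  by case: (w) w0 wa => //= z w' _ <-; rewrite mem_last !orbT.
- by rewrite !cat_path pv -ep qv -eq rw.
Qed.

(** A tour of all the vertices is given a tiny value.  Visiting every vertex, it
   can take in each of the closed walks into which the rest of the circulation
   decomposes; and since all the walks so obtained pass through [a0], they can be
   concatenated to balance their weights. *)
Theorem balanced_walks (w : W * W -> int) (a0 : W) :
    \sum_e m e *~ w e = 0 ->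
  exists S, [/\ walk_system S, forall x, x \in S -> x.1 != 0 &
    forall x, x \in S -> [/\ x.2.1 = a0, last x.2.1 x.2.2 = a0 &
                             weight step_count w x.2 = 0]].
Proof.
move=> w0; have [tour [tour0 tour_a0 tour_all tour_m]] := tour_exists a0.
pose k e := step_count (a0, tour) e.
have [|z [Vz z0 zm]] := rs_small HV (s :=
  [seq m e | e <- steps (a0, tour)]) (size tour).
  by move=> _ /mapP[e /tour_m em ->].
have Pzk e : P (m e - z *+ k e).
  have [ke|] := boolP (e \in steps (a0, tour)); last first.
    move=> /count_memPn ke; rewrite /k /step_count ke mulr0n subr0.
    exact: (rs_pos HV).
  have le : (k e <= size tour)%N.
    by rewrite -(size_pairmap pair a0 tour); exact: count_size.
  have -> : m e - z *+ k e = (m e - z *+ size tour) + z *+ (size tour - k e).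
    by rewrite -{1}(subnK le) mulrnDr opprD addrA addrAC subrK.
  apply: (rs_posD HV); first by apply: zm; apply: map_f.
  exact: scale_posMn (rs_pos HV Vz).
have Vzk e : V (m e - z *+ k e).
  apply: (rs_diff HV) => //; apply: scaleMn => //.
  rewrite -(subrK (m e) u) -addrA; apply: (rs_posD HV) => //.
  rewrite -sum_m (bigD1 e) //= addrAC subrr add0r.
  by apply: scale_pos_sum => f _ _; exact: (rs_pos HV).
pose S0 := [seq (m e - z *+ k e, (e.1, [:: e.2])) | e <- enum {: W * W}].
have hS0 : walk_system (S0 ++ [:: (z, (a0, tour))]).
  split.
    move=> x; rewrite mem_cat inE => /orP[/mapP[e _ ->]|/eqP ->].
      by rewrite wsize_walk; split => //; exact: Vzk.
    by rewrite wsize_walk lt0n size_eq0.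
  move=> e; rewrite big_cat big_seq1 big_map big_enum /= (bigD1 e) //=.
  rewrite big1 ?addr0 => [|f fe]; last first.
    by rewrite /step_count /steps /= -surjective_pairing (negPf fe) mulr0n.
  by rewrite {1}/step_count /steps /= -surjective_pairing eqxx mulr1n subrK.
have [S1 [hS1 S1_closed]] : exists S1,
    walk_system (S1 ++ [:: (z, (a0, tour))]) /\
    forall x, x \in S1 -> closed_walk x.2.
  by apply: walk_system_loops hS0 _ => x; rewrite inE => /eqP ->; apply/eqP.
pose A t := [/\ t.1 = a0, last a0 t.2 = a0 & forall v : W, v \in t.2].
pose ins (a b : W * seq W) :=
  let i := index b.1 (a.1 :: a.2) in (a.1, take i a.2 ++ b.2 ++ drop i a.2).
have hins a b : A a -> closed_walk b -> A (ins a b) /\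
    forall e, step_count (ins a b) e = (step_count a e + step_count b e)%N.
  case: a b => [c x] [d y] [/= -> xa0 xall] /eqP /= yd.
  have [i -> last_i] : exists2 i,
      ins (a0, x) (d, y) = (a0, take i x ++ y ++ drop i x) &
      last a0 (take i x) = d.
    have dx : d \in a0 :: x by rewrite inE xall orbT.
    exists (index d (a0 :: x)) => //; have := dx; rewrite -index_mem.
    move: (index _ _) (nth_index d dx) => n nd nx.
    rewrite (last_nth d) size_takel // -[RHS]nd.
    by case: n {nd} nx => //= n nx; rewrite nth_take.
  split.
    split => //.
      by rewrite !last_cat last_i yd -last_i -last_cat cat_take_drop.
    move=> v; have := xall v; rewrite -{1}(cat_take_drop i x) !mem_cat.
    by case/orP => ->; rewrite ?orbT.
  move=> e; rewrite -{3}(cat_take_drop i x) !step_count_cat last_i yd.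
  by rewrite -addnA; congr (_ + _)%N; rewrite addnC.
have [S2 [hS2 S2A sum_S2]] : exists S2, [/\ walk_system S2,
    forall x, x \in S2 -> A x.2 & \sum_(x <- S2) x.1 = z].
  have hS1' : walk_system ([:: (z, (a0, tour))] ++ S1).
    by apply: perm_column_system hS1; rewrite perm_catC.
  have [||S2 [? ? sum_S2]] := column_system_absorb sum_m hins hS1' _ S1_closed.
  - by move=> x; rewrite inE => /eqP ->.
  - by rewrite big_seq1.
  - by exists S2; split => //; rewrite sum_S2 big_seq1.
pose A' (t : W * seq W) := t.1 = a0 /\ last a0 t.2 = a0.
pose cat_walk (a b : W * seq W) := (a.1, a.2 ++ b.2).
have catA a b : A' a -> A' b -> A' (cat_walk a b).
  by move=> [a1 aw] [_ bw]; split => //; rewrite last_cat aw.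
have cat_cnt a b : A' a -> A' b -> forall e,
    step_count (cat_walk a b) e = (step_count a e + step_count b e)%N.
  case: a b => [c x] [d y] [/= -> xa0] [/= -> _] e.
  by rewrite /cat_walk step_count_cat /= xa0.
have [|S3 [hS3 S3A]] := column_system_balance sum_m catA cat_cnt w0 hS2.
  by move=> x /S2A[].
exists [seq x <- S3 | x.1 != 0]; split; first exact: column_system_nonzero.
  by move=> x; rewrite mem_filter => /andP[].
by move=> x; rewrite mem_filter => /andP[_ /S3A[[-> ->] ->]].
Qed.
End Walks.

(** ** Stacking everything over a small base *)

(** Since words are subject to no constraint here, the absorbing columns can be
   reduced to a tiny piece of a single letter. *)
Lemma stacking (E : finType) (m : E -> M) z :
    (forall e, V (m e)) -> \sum_e m e = u -> u != 0 -> V z -> z != 0 ->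
  exists S, column_system (fun (t : seq E) e => count_mem e t) m S /\
    P (z - \sum_(x <- S) x.1).
Proof.
move=> Vm sum_m u0 Vz z0.
have /existsP[e0 me0] : [exists e, m e != 0].
  apply: contraNT u0; rewrite negb_exists => /forallP m0.
  by rewrite -sum_m big1 // => e _; apply/eqP; rewrite -[_ == _]negbK.
have [|y [Vy y0 ym]] := rs_small HV (s := [:: m e0; z]) 1.
  by move=> x; rewrite !inE => /orP[] /eqP ->.
pose L := [seq (m e - y *+ (e == e0), [:: e]) | e <- enum E].
pose cnt (t : seq E) e := count_mem e t.
have wsize1 e : (0 < wsize cnt [:: e])%N.
  by rewrite /wsize (bigD1 e) //= /cnt /= eqxx.
have hS : column_system cnt m ([:: (y, [:: e0])] ++ L).
  split.
    move=> x; rewrite inE => /orP[/eqP ->//|/mapP[e _ ->]] /=; split => //.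
    apply: (rs_diff HV) => //; first by case: eqP => _;
      rewrite ?mulr1n ?mulr0n; [|exact: scale0].
    case: eqP => [->|_]; first by apply: ym; rewrite inE eqxx.
    by rewrite mulr0n subr0; exact: (rs_pos HV).
  move=> e; rewrite big_cat big_seq1 big_map big_enum /= (bigD1 e) //=.
  rewrite big1 ?addr0 => [|f fe]; last by rewrite /cnt /= (negPf fe) mulr0n.
  by rewrite /cnt /= eqxx eq_sym !addn0 mulr1n addrC subrK.
have [||||S [hS' _ sumS]] := column_system_absorb sum_m (A :=
  fun=> True) (B := fun=> True)
  (ins := cat) _ hS => //; last by exists S; split => //;
    rewrite sumS big_seq1; apply: ym; rewrite !inE eqxx orbT.
  by move=> a b _ _; split => // e; rewrite /cnt count_cat.
by rewrite big_seq1.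
Qed.
End Scale.

(** * Coordinates on a Cantor space *)

Lemma clopen_setC (T : topologicalType) (A : set T) : clopen A -> clopen (~` A).
Proof. exact: clopenC. Qed.

Lemma clopen_setD (T : topologicalType) (A B : set T) :
  clopen A -> clopen B -> clopen (A `\` B).
Proof. by move=> cA cB; rewrite setDE; apply: clopenI => //;
  exact: clopen_setC. Qed.

Lemma compact_chain (T : topologicalType) (A : set T) (O : nat -> set T) :
    compact A -> (forall n, open (O n)) -> (forall n, O n `<=` O n.+1) ->
    A `<=` \bigcup_n O n ->
  exists n, A `<=` O n.
Proof.
move=> cA oO sO AO; apply: contrapT => nA.
have {}sO m n : (m <= n)%N -> O m `<=` O n.
  elim: n => [|n IH]; first by rewrite leqn0 => /eqP ->.
  rewrite leq_eqVlt => /orP[/eqP ->//|]; rewrite ltnS => /IH.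
  by move=> mn x /mn; exact: sO.
pose F := filter_from [set: nat] (fun n => A `\` O n).
have FF : ProperFilter F.
  apply: filter_from_proper; last first.
    move=> n _; apply: contrapT => n0; apply: nA; exists n => x Ax.
    by apply: contrapT => Ox; apply: n0; exists x.
  apply: filter_from_filter; first by exists 0%N.
  move=> m n _ _; exists (maxn m n) => // x [Ax Ox].
  by split; split => // Omn; apply: Ox; apply: sO Omn; lia.
have FA : F A by exists 0%N => // x [].
have [p [Ap clp]] := cA F FF FA; have [n _ Onp] := AO p Ap.
have [q [[_ nOq] Oq]] := clp (A `\` O n) (O n) (ex_intro2 _ _ n I (fun _ H =>
  H))
  (open_nbhs_nbhs (conj (oO n) Onp)).
exact: nOq.
Qed.

Record coding (X : ptopologicalType) (code : X -> nat -> bool) : Prop := {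
  coding_compact : compact [set: X] ;
  coding_clopen : forall n, clopen [set x | code x n] ;
  coding_inj : forall x y, code x =1 code y -> x = y ;
  coding_surj : forall c, exists x, code x =1 c }.

Lemma cantor_coding (X : ptopologicalType) :
  is_cantor_space X -> exists code : X -> nat -> bool, coding code.
Proof.
move=> [f [cf [f' [cf' fK f'K]]]].
exists (fun x n => f' x n); split.
- have -> : [set: X] = f @` [set: cantor_space].
    by apply/seteqP; split => // x _; exists (f' x).
  apply: continuous_compact cantor_space_compact.
  exact: continuous_subspaceT.
- move=> n; have -> : [set x | f' x n] = (@proj nat (fun=> bool) n \o f')
  @^-1` [set true].
    by apply/seteqP; split => x /=; rewrite /proj /=; case: (f' x n).
  apply: preimage_clopen; first by split;
    [exact: discrete_open | exact: discrete_closed].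
  by move=> x; apply: continuous_comp; [exact: cf' | exact: proj_continuous].
- by move=> x y xy; rewrite -(f'K x) -(f'K y); congr f; apply/funext.
- by move=> c; exists (f c); move=> n; rewrite fK.
Qed.

Section Coding.
Variables (X : ptopologicalType) (code : X -> nat -> bool).
Hypothesis hC : coding code.

Lemma coding_bit n b : clopen [set x | code x n = b].
Proof.
case: b; first exact: coding_clopen hC n.
have -> : [set x | code x n = false] = ~` [set x | code x n].
  by apply/seteqP; split => x /=; case: (code x n).
exact: clopen_setC (coding_clopen hC n).
Qed.

Definition determined n (A : set X) :=
  forall x y, (forall k, (k < n)%N -> code x k = code y k) -> A x -> A y.

Definition cylinder n (x : X) : set X :=
  [set y | forall k, (k < n)%N -> code x k = code y k].

Lemma cylinder_clopen n x : clopen (cylinder n x).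
Proof.
elim: n => [|n IH].
  have -> : cylinder 0 x = setT by apply/seteqP; split.
  exact: clopenT.
have -> : cylinder n.+1 x = cylinder n x `&` [set y | code y n = code x n].
  apply/seteqP; split => y /=.
    by move=> h; split => [k kn|]; rewrite h //; exact: ltnW.
  move=> [h e] k; rewrite ltnS leq_eqVlt => /orP[/eqP ->//|]; exact: h.
exact/clopenI/coding_bit.
Qed.

Lemma determined_clopen n A : determined n A -> clopen A.
Proof.
have op B : determined n B -> open B.
  move=> dB; rewrite openE => x Bx.
  apply: (@filterS _ (nbhs x) _ (cylinder n x)); first by move=> y xy;
    exact: dB xy Bx.
  by apply: open_nbhs_nbhs; split => //; have [] := cylinder_clopen n x.
move=> dA; split; first exact: op.
rewrite -openC; apply: op => x y xy nAx Ay; apply: nAx.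
by apply: dA Ay => k kn; rewrite xy.
Qed.

Lemma determined_leq m n A : (m <= n)%N -> determined m A -> determined n A.
Proof. by move=> mn dA x y xy; apply: dA => k km; apply: xy;
  exact: leq_trans mn. Qed.

Lemma open_cylinder (U : set X) x : open U -> U x ->
  exists n, cylinder n x `<=` U.
Proof.
move=> oU Ux.
have cU : compact (~` U).
  by apply: subclosed_compact (coding_compact hC) _ => //; exact: open_closedC.
have [|||n hn] := compact_chain (O := fun n => ~` cylinder n x) cU.
- by move=> n; apply: closed_openC; have [] := cylinder_clopen n x.
- by move=> n y; apply: contra_not => h k kn; apply: h; exact: ltnW.
- move=> y nUy; apply: contrapT => nO; apply: nUy.
  suff <- : x = y by [].
  apply: (coding_inj hC) => n; apply: contrapT => ne; apply: nO.
  by exists n.+1 => // /(_ n (ltnSn n)).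
- by exists n => y xy; apply: contrapT => /hn.
Qed.

(** The points around which the cylinder of length [n] decides of membership in
   [A] form an increasing sequence of open sets, and they cover a compact
   space. *)
Lemma clopen_determined A : clopen A -> exists n, determined n A.
Proof.
move=> [oA cA].
have dO (B : set X) n : determined n [set x | cylinder n x `<=` B].
  by move=> x y xy xB z yz; apply: xB => k kn; rewrite xy // yz.
pose O n := [set x | cylinder n x `<=` A] `|` [set x | cylinder n x `<=` ~` A].
have [|||n hn] := @compact_chain _ setT O (coding_compact hC).
- by move=> n; apply: openU;
  [have [] := determined_clopen (dO A n) | have [] :=
  determined_clopen (dO (~` A) n)].
- move=> n x [xA|xA]; [left|right] => y xy; apply: xA => k kn; apply: xy;
  exact: ltnW.
- move=> x _; have [Ax|nAx] := pselect (A x).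
    by have [n xn] := open_cylinder oA Ax; exists n => //; left.
  by have [n xn] := open_cylinder (closed_openC cA) nAx; exists n => //; right.
- exists n => x y xy Ax; case: (hn x I) => [xA|xA]; first exact: xA.
  by case: (xA x).
Qed.

Lemma open_bigcup_clopen (U : set X) : open U ->
  U = \bigcup_n [set x | cylinder n x `<=` U] /\
  forall n, clopen [set x | cylinder n x `<=` U].
Proof.
move=> oU; split; last first.
  move=> n; apply: (@determined_clopen n) => x y xy xU z yz.
  by apply: xU => k kn; rewrite xy // yz.
apply/seteqP; split => [x Ux|x [n _]]; last by apply.
by have [n xn] := open_cylinder oU Ux; exists n.
Qed.

End Coding.

(** * Borel probability measures on a Cantor space *)

Section BorelMeasures.
Variables (X : ptopologicalType) (R : realType).
Implicit Types (mu nu : bprob X R) (A B : set X).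

Lemma open_measurable_borel A : open A -> measurable (A : set (borel X)).
Proof. by move=> oA; apply: sub_sigma_algebra. Qed.

Lemma clopen_measurable A : clopen A -> measurable (A : set (borel X)).
Proof. by move=> [oA _]; exact: open_measurable_borel. Qed.

Definition mass mu A : R := fine (mu A).

Lemma massK mu A : clopen A -> (mass mu A)%:E = mu A.
Proof. by move=> cA; rewrite fineK // fin_num_measure //;
  exact: clopen_measurable. Qed.

Lemma mass_eq mu nu A B : clopen A -> clopen B -> mass mu A = mass nu B ->
  mu A = nu B.
Proof. by move=> cA cB e; rewrite -massK // e massK. Qed.

Lemma mass_ge0 mu A : 0 <= mass mu A.
Proof. exact: fine_ge0. Qed.

Lemma massT mu : mass mu setT = 1.
Proof. by rewrite /mass probability_setT. Qed.

Lemma mass0 mu : mass mu set0 = 0.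
Proof. by rewrite /mass measure0. Qed.

Lemma massU mu A B : clopen A -> clopen B -> A `&` B = set0 ->
  mass mu (A `|` B) = mass mu A + mass mu B.
Proof.
move=> cA cB AB; have mA := clopen_measurable cA;
  have mB := clopen_measurable cB.
by rewrite /mass measureU // fineD // fin_num_measure.
Qed.

Lemma massD mu A B : clopen A -> clopen B -> B `<=` A ->
  mass mu (A `\` B) = mass mu A - mass mu B.
Proof.
move=> cA cB BA; apply/eqP; rewrite eq_sym subr_eq -massU ?setDUK //.
- by rewrite setUC setDUK.
- exact: clopen_setD.
- by rewrite setDE -setIA setICl setI0.
Qed.

Lemma mass_le mu A B : clopen A -> clopen B -> A `<=` B ->
  mass mu A <= mass mu B.
Proof. by move=> cA cB AB; rewrite -subr_ge0 -massD //; exact: mass_ge0. Qed.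

Lemma indic_continuous A : clopen A -> continuous (\1_A : X -> R).
Proof.
move=> [oA cA]; apply/continuousP => B _; rewrite preimage_indic.
do 2 case: ifP => _; [exact: openT | exact: oA | exact: closed_openC | exact:
  open0].
Qed.

Lemma mass_continuous A : clopen A -> continuous (fun mu => mass mu A).
Proof.
move=> cA; pose f : contfun X R := exist _ _ (indic_continuous cA).
have -> : (fun mu => mass mu A) = (fun mu => bprob_int mu f).
  apply/funext => mu; rewrite /mass /bprob_int /Rintegral /= integral_indic //.
    by rewrite setIT.
  exact: clopen_measurable.
have ci : continuous (@bprob_int X R : bprob X R -> {ptws contfun X R -> R}).
  by apply/continuousP => B oB; exists B.
have cp : continuous (fun h : {ptws contfun X R -> R} => h f).
  exact: (@proj_continuous _ (fun=> R) f).
by move=> mu; apply: (@continuous_comp _ _ _ _ (fun h : {ptws contfun X R ->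
  R} => h f)); [exact: ci | exact: cp].
Qed.

Lemma mass_fibers_seq (I : eqType) (p : X -> I) (s : seq I) mu A :
    clopen A -> (forall i, clopen [set x | p x = i]) -> uniq s ->
  clopen (A `&` [set x | p x \in s]) /\
  mass mu (A `&` [set x | p x \in s]) = \sum_(i <- s) mass mu (A `&` [set x |
    p x = i]).
Proof.
move=> cA cp; elim: s => [_|i s IH /= /andP[is_ /IH[cs es]]].
  rewrite big_nil; have -> : A `&` [set x | p x \in [::]] = set0.
    by apply/seteqP; split => x // [].
  by rewrite mass0; split => //; exact: clopen0.
have ci : clopen (A `&` [set x | p x = i]) by exact: clopenI.
have -> : A `&` [set x | p x \in i :: s] =
    (A `&` [set x | p x = i]) `|` (A `&` [set x | p x \in s]).
  rewrite -setIUr; congr (_ `&` _); apply/seteqP; split => x /=.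
    by rewrite inE => /orP[/eqP|]; [left|right].
  by rewrite inE => -[->|->]; rewrite ?eqxx ?orbT.
split; first exact: clopenU.
rewrite big_cons -es massU //; apply/seteqP; split => x //= [[_ pi] [_ ps]].
by rewrite -pi ps in is_.
Qed.

Lemma mass_fibers (I : finType) (p : X -> I) mu A :
    clopen A -> (forall i, clopen [set x | p x = i]) ->
  mass mu A = \sum_i mass mu (A `&` [set x | p x = i]).
Proof.
move=> cA cp; rewrite -big_enum.
have [_ <-] := mass_fibers_seq mu cA cp (enum_uniq I); congr (mass mu _).
by apply/seteqP; split => [x Ax|x []//]; split => //=; rewrite mem_enum.
Qed.

Variable code : X -> nat -> bool.
Hypothesis hC : coding code.
Local Notation cylinder := (cylinder code).

Lemma clopen_generate_borel :
  @measurable _ (borel X) = <<s [set A : set (borel X) | clopen (A : set X)] >>.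
Proof.
apply/seteqP; split; last first.
  by apply: smallest_sub; [exact: sigma_algebra_measurable | exact:
    clopen_measurable].
apply: smallest_sub; first exact: smallest_sigma_algebra.
move=> A oA; have [eA cA] := open_bigcup_clopen hC oA.
by rewrite eA; apply: sigma_algebra_bigcup => n; apply: sub_sigma_algebra;
  exact: cA.
Qed.

Lemma clopen_measure_unique (m1 m2 : {measure set (borel X) -> \bar R}) :
    (m1 setT < +oo)%E -> (forall A : set (borel X), clopen (A : set X) ->
      m1 A = m2 A) ->
  forall A : set (borel X), measurable A -> m1 A = m2 A.
Proof.
move=> m1T m12 A mA.
apply: (measure_unique [set A : set (borel X) | clopen (A : set X)] (fun=>
  setT)) => //.
- exact: clopen_generate_borel.
- by move=> B C; exact: clopenI.
- by move=> _; exact: clopenT.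
- by rewrite bigcup_const //; exists 0%N.
Qed.

Lemma clopen_bprob_eq mu nu :
  (forall A, clopen A -> mass mu A = mass nu A) -> mu = nu.
Proof.
move=> mn; apply: bprob_eq; apply: clopen_measure_unique.
  by apply: (@le_lt_trans _ _ 1%E); [exact: probability_le1 | exact: ltry].
by move=> A cA; apply: mass_eq => //; exact: mn.
Qed.

Lemma continuous_measurable_borel (h : X -> X) : continuous h ->
  measurable_fun setT (h : borel X -> borel X).
Proof.
move=> ch; apply: measurability => // _ [A oA <-]; rewrite setTI.
by apply: open_measurable_borel; move/continuousP : ch; exact.
Qed.

Lemma clopen_invariant mu (h : X -> X) : continuous h ->
    (forall A, clopen A -> mass mu (h @^-1` A) = mass mu A) ->
  invariant_measure mu h.
Proof.
move=> ch hA; have mh := continuous_measurable_borel ch.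
pose m2 : {measure set (borel X) -> \bar R} :=
  @measure_function_pushforward__canonical__measure_function_Measure _ _ _ _ R
    mu _ mh.
apply: (@clopen_measure_unique m2 mu);
  first by rewrite /= /pushforward preimage_setT probability_setT ltry.
move=> A cA; apply: mass_eq => //; last exact: hA.
exact: preimage_clopen.
Qed.

Lemma invariant_mass mu (h : X -> X) A : invariant_measure mu h -> clopen A ->
  mass mu (h @^-1` A) = mass mu A.
Proof. by move=> hmu cA; rewrite /mass -[mu A]hmu //;
  exact: clopen_measurable. Qed.

Lemma set1_bigcap_cylinder x : [set x] = \bigcap_n cylinder n x.
Proof.
apply/seteqP; split => [y -> n _ //|y xy].
by apply: (coding_inj hC) => n; rewrite -(xy n.+1).
Qed.

(** Points are null: no subset of a singleton has a mass strictly between zero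
   and that of the singleton. *)
Lemma mass_cylinder_small mu x (e : R) : atomless mu -> 0 < e ->
  exists n, mass mu (cylinder n x) < e.
Proof.
move=> am e0.
have mcyl n : measurable (cylinder n x : set (borel X)).
  by apply: clopen_measurable; exact: (cylinder_clopen hC).
have mx : measurable ([set x] : set (borel X)).
  by rewrite set1_bigcap_cylinder;
    apply: (@bigcapT_measurable _ (borel X)) => n; exact: mcyl.
have mux : mu [set x] = 0%E.
  apply/eqP; rewrite eq_le measure_ge0 andbT leNgt; apply/negP => /(am _ mx).
  move=> [B [mB Bx /andP[B0 Blt]]].
  have [Bxx|nBx] := pselect (B x).
    suff e1 : B = [set x] by rewrite e1 ltxx in Blt.
    by apply/seteqP; split => // y ->.
  suff e1 : B = set0 by rewrite e1 measure0 ltxx in B0.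
  by apply/seteqP; split => // y By; have := Bx _ By => /= yx; rewrite yx in By.
pose F n : set (borel X) := cylinder n x.
have F0 : (mu (F 0%N) < +oo)%E.
  by rewrite -massK ?ltry; [|exact: cylinder_clopen hC _ _].
have mF : measurable (\bigcap_n F n) by rewrite -set1_bigcap_cylinder.
have ndF : {homo F : n m / (n <= m)%N >-> (m <= n)%O}.
  move=> m n mn; apply/subsetPset => y yn k km; apply: yn;
    exact: leq_trans km mn.
have muF : mu (\bigcap_n F n) = 0%E by rewrite -mux set1_bigcap_cylinder.
have : (mu \o F) n @[n --> \oo] --> 0%E by rewrite -muF;
  exact: nonincreasing_cvg_mu.
move=> /fine_cvgP[_ /cvgrPdist_lt /(_ e e0)] [N _ /(_ N (leqnn N))] /=.
rewrite sub0r normrN ger0_norm; first by exists N.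
exact: mass_ge0.
Qed.
End BorelMeasures.

(** * The scale of a dynamical simplex *)

Section Simplex.
Variables (X : ptopologicalType) (R : realType) (K : set (bprob X R)).
Hypothesis hK : dynamical_simplex K.
Variable code : X -> nat -> bool.
Hypothesis hC : coding code.
Local Notation cylinder := (cylinder code).
Implicit Types (A B C U : set X).

(** As values are functions on the subtype [K], two clopen sets have the same
   mass for all the elements of the simplex when their values are equal. *)
Definition kval A : K -> R := fun mu => mass (set_val mu) A.

Definition clopen_val (f : K -> R) : Prop := exists2 A, clopen A & f = kval A.

Definition null_or_pos (f : K -> R) : Prop := f = 0 \/ forall mu, 0 < f mu.

Lemma simplex_point : exists mu : K, True.
Proof. by have [mu Kmu] := ds_nonempty hK; exists (SigSub (mem_set Kmu)). Qed.

Lemma set_valK (mu : bprob X R) (Kmu : K mu) :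
  set_val (SigSub (mem_set Kmu) : K) = mu.
Proof. by rewrite set_valE. Qed.

Lemma simplexP (f : bprob X R -> Prop) :
  (forall mu, K mu -> f mu) <-> (forall mu : K, f (set_val mu)).
Proof.
split=> [h mu|h mu Kmu]; first by apply: h; exact: set_valP.
by rewrite -(set_valK Kmu).
Qed.

Lemma kval_eq A B : clopen A -> clopen B ->
  kval A = kval B <-> (forall mu, K mu -> mu A = mu B).
Proof.
move=> cA cB; split=> [AB|/(simplexP (fun mu => mu A = mu B)) AB].
  apply/(simplexP (fun mu => mu A = mu B)) => mu; apply: mass_eq => //.
  exact: (congr1 (@^~ mu) AB).
by apply/funext => mu; rewrite /kval /mass AB.
Qed.

Lemma kvalU A B : clopen A -> clopen B -> A `&` B = set0 ->
  kval (A `|` B) = kval A + kval B.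
Proof. by move=> cA cB AB; apply/funext => mu; rewrite /kval massU. Qed.

Lemma kvalD A B : clopen A -> clopen B -> B `<=` A ->
  kval (A `\` B) = kval A - kval B.
Proof. by move=> cA cB BA; apply/funext => mu; rewrite /kval massD. Qed.

Lemma kval0 : kval set0 = 0.
Proof. by apply/funext => mu; rewrite /kval mass0. Qed.

Lemma kval_gt0 A mu : clopen A -> A !=set0 -> 0 < kval A mu.
Proof.
move=> [oA cA] A0; rewrite -lte_fin [(kval A mu)%:E]massK //.
exact: (ds_full_support hK (set_valP mu)).
Qed.

Lemma kval_eq0 A : clopen A -> kval A = 0 -> A = set0.
Proof.
move=> cA A0; have [mu _] := simplex_point.
have [//|/set0P nA] := eqVneq A set0.
by have := kval_gt0 mu cA nA; rewrite A0 ltxx.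
Qed.

Lemma kval_pos A : clopen A -> null_or_pos (kval A).
Proof.
move=> cA; have [->|/set0P nA] := eqVneq A set0; first by left; exact: kval0.
by right => mu; exact: kval_gt0.
Qed.

Lemma kval_bounded_below U : clopen U -> U !=set0 ->
  exists2 e : R, 0 < e & forall mu, e <= kval U mu.
Proof.
move=> cU U0.
have [c Kc cmin] := @compact_EVT_min _ R (fun mu =>
  mass mu U) K (ds_nonempty hK)
  (ds_compact hK) (continuous_subspaceT (mass_continuous cU)).
have Kc' : K c by exact: set_mem.
exists (mass c U); first by rewrite -(set_valK Kc'); exact: kval_gt0.
by move=> mu; apply: cmin; apply: mem_set; exact: set_valP.
Qed.

(** Cylinders of a given length are uniformly small: by compactness of the
   simplex around each point, then by compactness of the space. *)
Lemma cylinder_small (e : R) : 0 < e ->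
  exists n, forall x mu, kval (cylinder n x) mu < e.
Proof.
move=> e0.
have cyl_le mu m n x : (m <= n)%N ->
  mass mu (cylinder n x) <= mass mu (cylinder m x) :> R.
  move=> mn; apply: mass_le; [exact: cylinder_clopen hC _ _|exact:
    cylinder_clopen hC _ _|].
  by move=> y xy k km; apply: xy; exact: leq_trans km mn.
have small x : exists n, forall mu : K, kval (cylinder n x) mu < e.
  pose O n := [set mu : bprob X R | mass mu (cylinder n x) < e].
  have [|||n Kn] := compact_chain (O := O) (ds_compact hK).
  - move=> n; have := @mass_continuous _ R _ (cylinder_clopen hC n x).
    by move/continuousP => /(_ [set r | r < e]); apply; exact: open_lt.
  - by move=> n mu; apply: le_lt_trans; exact: cyl_le.
  - move=> mu Kmu; have [n hn] :=
    mass_cylinder_small hC x (ds_atomless hK Kmu) e0.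
    by exists n.
  by exists n => mu; apply: Kn; exact: set_valP.
pose O n := [set x | forall mu : K, kval (cylinder n x) mu < e].
have [|||n hn] := compact_chain (O := O) (coding_compact hC).
- move=> n; suff : clopen (O n) by case.
  apply: (@determined_clopen _ _ hC n) => x y xy xe mu.
  suff <- : cylinder n x = cylinder n y by [].
  by apply/seteqP; split => z h k kn; [rewrite -xy // h | rewrite xy // h].
- by move=> n x xe mu; apply: le_lt_trans (xe mu); exact: cyl_le.
- by move=> x _; have [n hn] := small x; exists n.
by exists n => x mu; exact: (hn x I).
Qed.

Definition bits n (x : X) : {ffun 'I_n -> bool} := [ffun k : 'I_n => code x k].

Lemma bitsP n x y :
  bits n x = bits n y <-> (forall k, (k < n)%N -> code x k = code y k).
Proof.
split=> [/ffunP h k kn|h]; first by have := h (Ordinal kn); rewrite !ffunE.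
by apply/ffunP => k; rewrite !ffunE h.
Qed.

Lemma bits_clopen n t : clopen [set x | bits n x = t].
Proof.
apply: (@determined_clopen _ _ hC n) => x y xy /= <-.
by apply/bitsP => k kn; rewrite xy.
Qed.

Lemma kval_fibers (I : finType) (p : X -> I) A :
    clopen A -> (forall i, clopen [set x | p x = i]) ->
  kval A = \sum_i kval (A `&` [set x | p x = i]).
Proof. by move=> cA cp; rewrite fct_sumE; apply/funext => mu;
  exact: mass_fibers. Qed.

Lemma kval_fibers_seq (I : eqType) (p : X -> I) (s : seq I) :
    (forall i, clopen [set x | p x = i]) -> uniq s ->
  kval [set x | p x \in s] = \sum_(i <- s) kval [set x | p x = i].
Proof.
move=> cp us; rewrite fct_sumE; apply/funext => mu.
have [_] := mass_fibers_seq (set_val mu) clopenT cp us.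
rewrite setTI /kval => ->; by apply: eq_bigr => i _; rewrite setTI.
Qed.

Lemma kval_embed A B : clopen A -> clopen B -> null_or_pos (kval B - kval A) ->
  exists C, [/\ clopen C, C `<=` B & kval C = kval A].
Proof.
move=> cA cB [/eqP|AB].
  by rewrite subr_eq0 => /eqP BA; exists B; split.
have [|C [cC CB CA]] := ds_subset hK cA cB.
  apply/(simplexP (fun mu => (mu A < mu B)%E)) => mu.
  by rewrite -!massK // lte_fin -subr_gt0; exact: AB.
by exists C; split => //; apply/(kval_eq cC cA).
Qed.

Lemma null_or_posD f g : null_or_pos f -> null_or_pos g -> null_or_pos (f + g).
Proof.
move=> [->|f0] [->|g0]; rewrite ?addr0 ?add0r; [by left|by right|by right|].
by right => mu; rewrite addr_gt0.
Qed.

Lemma small_clopen (e : R) U : 0 < e -> clopen U -> U !=set0 ->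
  exists C, [/\ clopen C, C `<=` U, C !=set0 & forall mu, kval C mu < e].
Proof.
move=> e0 cU [x Ux]; have [n small] := cylinder_small e0.
have cx := cylinder_clopen hC n x.
exists (U `&` cylinder n x); split.
- exact: clopenI.
- exact: subIsetl.
- by exists x; split.
- move=> mu; apply: le_lt_trans (small x mu); apply: mass_le => //.
  exact: clopenI.
Qed.

(** For the Riesz property, a set of value [a] and one of value [x] are chosen
   inside a set of value [a + b], and the second one is cut along the first. *)
Lemma clopen_val_scale : riesz_scale null_or_pos clopen_val (kval setT).
Proof.
split.
- by left.
- exact: null_or_posD.
- move=> f [//|f0] [fN|fN]; first by apply/eqP; rewrite -oppr_eq0 fN.
  have [mu _] := simplex_point.
  by have := addr_gt0 (f0 mu) (fN mu); rewrite subrr ltxx.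
- move=> f n [f0|f0]; [left|right].
    apply/funext => mu; have := congr1 (@^~ mu) f0; rewrite /= natmulfctE.
    by move/eqP; rewrite mulrn_eq0 /= => /eqP.
  by move=> mu; have := f0 mu; rewrite natmulfctE pmulrn_lgt0.
- by move=> _ [A cA ->]; exact: kval_pos.
- by exists setT => //; exact: clopenT.
- move=> _ _ [A cA ->] [B cB ->] AB.
  have [C [cC CB <-]] := kval_embed cA cB AB.
  by exists (B `\` C); [exact: clopen_setD | rewrite kvalD].
- move=> _ _ _ [A cA ->] [B cB ->] [B' cB' ->] [C cC BC] [D cD AD].
  have [B1 [cB1 B1C B1B]] : exists B1, [/\ clopen B1,
    B1 `<=` C & kval B1 = kval B].
    by apply: kval_embed => //; rewrite -BC addrC addKr; exact: kval_pos.
  have [A1 [cA1 A1C A1A]] : exists A1, [/\ clopen A1,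
    A1 `<=` C & kval A1 = kval A].
    by apply: kval_embed => //; rewrite -BC AD; exact: kval_pos.
  have eB' : kval B' = kval (C `\` B1) by rewrite kvalD // -BC B1B addrC addKr.
  have cI := clopenI cA1 cB1.
  have cE := clopen_setD cA1 cB1.
  have cF := clopen_setD cC cB1.
  have eE : kval A - kval (A1 `&` B1) = kval (A1 `\` B1).
    by rewrite -A1A -kvalD // setDIr setDv set0U.
  exists (kval (A1 `&` B1)); split.
  + by exists (A1 `&` B1).
  + exists (B1 `\` (A1 `&` B1)); first exact: clopen_setD.
    by rewrite kvalD // B1B.
  + by rewrite eE; exists (A1 `\` B1).
  + rewrite eE eB'; exists ((C `\` B1) `\` (A1 `\` B1)).
      exact: clopen_setD.
    by rewrite [RHS]kvalD //; move=> x [Ax nBx]; split => //; exact: A1C.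
- move=> _ _ [A cA ->] [B cB ->] B0.
  have [|e e0 eB] := kval_bounded_below cB.
    by apply/set0P; apply: contraNneq B0 => ->; rewrite kval0.
  have [n small] := cylinder_small e0.
  exists [seq kval (A `&` [set x | bits n x = t]) | t <- enum {: {ffun 'I_n ->
    bool}}].
    by rewrite big_map big_enum /= -kval_fibers //; exact: bits_clopen.
  move=> _ /mapP[t _ ->]; set D := A `&` _.
  have cD : clopen D by apply: clopenI => //; exact: bits_clopen.
  split; first by exists D.
  have [D0|/set0P[x [_ Dx]]] := eqVneq D set0.
    by exists B => //; rewrite D0 kval0 subr0.
  have Dlt mu : kval D mu < kval B mu.
    apply: lt_le_trans (eB mu); apply: le_lt_trans (small x mu).
    apply: mass_le => //; first exact: cylinder_clopen hC _ _.
    by move=> y [_ Dy]; apply/bitsP; rewrite Dx Dy.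
  have [|C [cC CB CD]] := @kval_embed D B cD cB.
    by right => mu; rewrite subr_gt0.
  by exists (B `\` C); [exact: clopen_setD | rewrite kvalD // CD].
- move=> s n sV.
  have [e e0 es] : exists2 e : R, 0 < e & forall z, z \in s ->
    forall mu, e <= z mu.
    elim: s sV => [|z s IH] sV; first by exists 1.
    have [|e e0 es] := IH; first by move=> y ys; apply: sV; rewrite inE ys orbT.
    have [[A cA zA] z0] := sV z (mem_head _ _).
    have [|d d0 dA] := kval_bounded_below cA.
      by apply/set0P; apply: contraNneq z0 => A0; rewrite zA A0 kval0.
    exists (Num.min e d); first by rewrite lt_min e0.
    move=> y; rewrite inE => /orP[/eqP -> mu|/es ye mu]; rewrite ge_min.
      by rewrite zA dA orbT.
    by rewrite ye.
  have eN0 : 0 < e / n.+1%:R by rewrite divr_gt0.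
  have [C [cC _ C0 Ce]] := small_clopen eN0 clopenT (ex_intro _ point I).
  exists (kval C); split; first by exists C.
    by apply/eqP => /(kval_eq0 cC) eC; rewrite eC in C0; case: C0.
  move=> z /es ez; right => mu; rewrite /= natmulfctE subr_gt0.
  apply: lt_le_trans (ez mu); rewrite -mulr_natr.
  apply: (@le_lt_trans _ _ (kval C mu * n.+1%:R)).
    by rewrite ler_wpM2l ?ler_nat //; exact: mass_ge0.
  by rewrite -ltr_pdivlMr.
Qed.
End Simplex.

Arguments kval {X R} K A.
Arguments clopen_val {X R} K f.

(** * Limits of finite partial isomorphisms *)

Section Limits.
Variables (X : ptopologicalType) (R : realType) (K : set (bprob X R)).
Hypothesis hK : dynamical_simplex K.
Variable code : X -> nat -> bool.
Hypothesis hC : coding code.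
Implicit Types (A B C U : set X).
Local Notation cylinder := (cylinder code).

Definition fiber (L : Type) (l : X -> L) i : set X := [set x | l x = i].

(** A finite partial isomorphism sends the atoms of a clopen partition to the
   atoms of another one of the same values; the partitions are encoded by
   labellings, and corresponding atoms have the same label. *)
Definition matching (L : Type) (l l' : X -> L) : Prop :=
  forall i, [/\ clopen (fiber l i), clopen (fiber l' i) &
                kval K (fiber l i) = kval K (fiber l' i)].

Definition linked (L : Type) (l l' : X -> L) : Prop :=
  forall S : set L, l @^-1` S = l' @^-1` S ->
    l @^-1` S = set0 \/ l @^-1` S = setT.

Lemma matching_sym L (l l' : X -> L) : matching l l' -> matching l' l.
Proof. by move=> ll' i; have [] := ll' i; split. Qed.

Lemma linked_sym L (l l' : X -> L) : linked l l' -> linked l' l.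
Proof. by move=> ll' S e; rewrite e; apply: ll'. Qed.

Lemma labels_clopen L (l : X -> L) (S : set L) :
  (forall i, clopen (fiber l i)) -> clopen (l @^-1` S).
Proof.
move=> cl; have op T : open (l @^-1` T).
  have -> : l @^-1` T = \bigcup_(i in T) fiber l i.
    apply/seteqP; split => [x Tx|x [i Ti lx]]; first by exists (l x).
    by rewrite /preimage /= (lx : l x = i).
  by apply: bigcup_open => i _; have [] := cl i.
by split; [exact: op | rewrite -openC preimage_setC; exact: op].
Qed.

Lemma labels_kval (L : countType) (l l' : X -> L) (S : set L) :
  matching l l' -> kval K (l @^-1` S) = kval K (l' @^-1` S).
Proof.
move=> ll'; pose T n : set L := [set i | S i /\ pickle i = n].
have cl i : clopen (fiber l i) by have [] := ll' i.
have cl' i : clopen (fiber l' i) by have [] := ll' i.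
have decomp (f : X -> L) (mu : bprob X R) : (forall i, clopen (fiber f i)) ->
    mu (f @^-1` S) = (\sum_(0 <= n <oo | n \in setT) mu (f @^-1` T n))%E.
  move=> cf; have -> : f @^-1` S = \bigcup_n f @^-1` T n.
    by apply/seteqP; split => [x Sx|x [n _ []//]]; exists (pickle (f x)).
  rewrite measure_bigcup //.
    by move=> n _; apply: clopen_measurable; exact: labels_clopen.
  by apply/trivIsetP => i j _ _ ij; apply/seteqP; split => // x [[_ ei] [_ ej]];
    rewrite -ei ej eqxx in ij.
have cT (f : X -> L) n : (forall i, clopen (fiber f i)) -> clopen (f @^-1` T n).
  by move=> cf; exact: labels_clopen.
apply/(kval_eq _ (labels_clopen _ cl) (labels_clopen _ cl')) => mu Kmu.
rewrite !decomp //; apply: eq_eseriesr => n _.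
have [[i [Si ni]]|nT] := pselect (exists i, T n i).
  have fT (f : X -> L) : f @^-1` T n = fiber f i.
    apply/seteqP; split => x; last by move=> e; split; rewrite e.
    by move=> [_ e]; apply: (pcan_inj pickleK); rewrite e ni.
  by rewrite !fT; have [ci ci' /(kval_eq K ci ci')] := ll' i; exact.
have fT (f : X -> L) : f @^-1` T n = set0.
  by apply/seteqP; split => // x Tx; apply: nT; exists (f x).
by rewrite !fT.
Qed.

(** One tiny piece [y] of [N] is put into [E], and another one, [y'], is kept out
   of it; the rest of [D'] still has room for what remains of [D `&` W]. *)
Lemma split_clopen D D' W N : clopen D -> clopen D' -> clopen W -> clopen N ->
    N `<=` D' -> N !=set0 -> kval K D = kval K D' ->
  exists E, [/\ clopen E, E `<=` D', kval K E = kval K (D `&` W) &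
    D `&` W !=set0 -> D `\` W !=set0 -> E `&` N !=set0 /\ N `\` E !=set0].
Proof.
move=> cD cD' cW cN ND' N0 DD'.
have cI := clopenI cD cW; have cM := clopen_setD cD cW.
have [DW0|/set0P I0] := eqVneq (D `&` W) set0.
  exists set0; split => //; [exact: clopen0 | by rewrite DW0 |].
  by rewrite DW0 => -[].
have [DW0|/set0P M0] := eqVneq (D `\` W) set0.
  exists D'; split => //; last by rewrite DW0 => _ [].
  rewrite -DD'; congr kval; apply/seteqP; split => [x Dx|x []//].
  by split => //; apply: contrapT => nW; have : (D `\` W) x by []; rewrite DW0.
have [e1 e1_gt0 I_e1] := kval_bounded_below hK cI I0.
have [e2 e2_gt0 M_e2] := kval_bounded_below hK cM M0.
have [e3 e3_gt0 N_e3] := kval_bounded_below hK cN N0.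
pose e := Num.min e1 (Num.min e2 e3).
have e_gt0 : 0 < e by rewrite !lt_min e1_gt0 e2_gt0.
have [e_e1 e_e2 e_e3] : [/\ e <= e1, e <= e2 & e <= e3].
  by rewrite !ge_min !lexx !orbT.
have [y [cy yN [x0 yx0] ye]] := small_clopen hK hC e_gt0 cN N0.
have cNy := clopen_setD cN cy.
have [|y' [cy' y'N [x1 y'x1] y'e]] := small_clopen hK hC e_gt0 cNy.
  apply: contrapT => Ny0; have [mu _] := simplex_point hK.
  have := lt_le_trans (ye mu) (le_trans e_e3 (N_e3 mu)).
  rewrite ltNge => /negP; apply; apply: mass_le => // x Nx.
  by apply: contrapT => nyx; apply: Ny0; exists x.
have yy' : y `&` y' = set0 by apply/seteqP; split => // x [yx /y'N[]].
have yD' : y `<=` D' by move=> x /yN /ND'.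
have cyy' : clopen (y `|` y') by exact: clopenU.
have [|y1 [cy1 y1I y1y]] := kval_embed hK cy cI.
  right => mu; rewrite subr_gt0; apply: lt_le_trans (ye mu) _.
  exact: le_trans e_e1 (I_e1 mu).
pose G := (D `&` W) `\` y1; pose F := D' `\` (y `|` y').
have cG : clopen G by exact: clopen_setD.
have cF : clopen F by exact: clopen_setD.
have GF mu : kval K G mu < kval K F mu.
  rewrite /G /F !kvalD //; last by move=> x [/yN|/y'N[]] /ND'.
  rewrite y1y kvalU // -DD'.
  have -> : kval K D = kval K (D `&` W) + kval K (D `\` W).
    rewrite -kvalU //.
      by rewrite setUIDK.
    by apply/seteqP; split => // x [[_ ?] []].
  rewrite -[ltLHS]/(kval K (D `&` W) mu - kval K y mu).
  rewrite -[ltRHS]/(kval K (D `&` W) mu + kval K (D `\` W) mu - (kval K y mu +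
    kval K y' mu)).
  have := lt_le_trans (y'e mu) (le_trans e_e2 (M_e2 mu)); lra.
have [|E0 [cE0 E0F E0G]] := kval_embed hK cG cF; first by right => mu;
  rewrite subr_gt0.
have E0y : E0 `&` y = set0.
  by apply/seteqP; split => // x [/E0F[_ nyx] yx]; apply: nyx; left.
exists (E0 `|` y); split.
- exact: clopenU.
- by move=> x [/E0F[]//|/yD'].
- by rewrite kvalU // E0G /G kvalD // y1y subrK.
- move=> _ _; split; first by exists x0; split; [right | exact: yN].
  exists x1; split; first by have [] := y'N _ y'x1.
  by move=> [/E0F[_]|yx1]; [apply; right | have [] := y'N _ y'x1].
Qed.

(** Refining a partial isomorphism by a clopen set [b].  In each atom the image
   of the new piece and its complement are made to meet a common atom of the
   refined partition, so that both or neither lie in a union of atoms that is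
   sent to itself: such a union is then one of the coarser partition. *)
Lemma matching_refine (L : Type) (l l' : X -> L) (b : X -> bool) :
    matching l l' -> linked l l' -> clopen [set x | b x] ->
  exists b' : X -> bool,
    matching (fun x => (b x, l x)) (fun x => (b' x, l' x)) /\
    linked (fun x => (b x, l x)) (fun x => (b' x, l' x)).
Proof.
move=> ll' lk cb.
have cnb : clopen [set x | ~ b x] by exact: clopen_setC cb.
have fiber_nonempty i : fiber l i !=set0 <-> fiber l' i !=set0.
  have [c1 c2 e] := ll' i; split=> /set0P n0; apply/set0P;
    apply: contraNneq n0 => f0.
    by apply/eqP/(kval_eq0 hK c1); rewrite e f0 kval0.
  by apply/eqP/(kval_eq0 hK c2); rewrite -e f0 kval0.
have /choice[E hE] i : exists E, [/\ clopen E, E `<=` fiber l' i,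
    kval K E = kval K (fiber l i `&` [set x | b x]) &
    fiber l i `&` [set x | b x] !=set0 -> fiber l i `\` [set x | b x] !=set0 ->
    exists x y, [/\ E x, (fiber l' i `\` E) y, l x = l y & b x = b y]].
  have [c1 c2 e] := ll' i.
  have [f0|/set0P f0] := eqVneq (fiber l' i) set0.
    exists set0; split => //; first exact: clopen0.
      rewrite (_ : fiber l i = set0) ?set0I // ; apply: (kval_eq0 hK c1).
      by rewrite e f0 kval0.
    move=> [x [lx _]]; have /fiber_nonempty[y] : fiber l i !=set0 by exists x.
    by rewrite f0.
  have [x0 l'x0] := f0.
  have cbx : clopen [set x | b x = b x0].
    case: (b x0) => //; rewrite (_ : [set x | _] = [set x | ~ b x]) //.
    by apply/seteqP; split => x /=; case: (b x).
  have [c3 _ _] := ll' (l x0).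
  have cN := clopenI c2 (clopenI c3 cbx).
  have [||F [cF FD' eF hF]] := split_clopen c1 c2 cb cN _ _ e.
  - by move=> x [].
  - by exists x0; split.
  exists F; split => // I0 M0;
    have [[x [Fx [_ [lx bx]]]] [y [[ly [ly2 bby]] nFy]]] := hF I0 M0.
  by exists x, y; split => //; [rewrite lx ly2 | rewrite bx bby].
pose b' x := `[< E (l' x) x >].
have fib' c i : fiber (fun x => (b' x, l' x)) (c, i) =
    if c then E i else fiber l' i `\` E i.
  have [_ ED _ _] := hE i.
  apply/seteqP; split => x.
    by case=> + <-; rewrite /b'; case: c => /asboolP.
  case: c => [Ex|[lx nEx]]; rewrite /fiber /= /b'.
    by have lx : l' x = i := ED _ Ex; rewrite lx (asboolT Ex).
  by rewrite lx (asboolF nEx).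
have fib c i : fiber (fun x => (b x, l x)) (c, i) =
    if c then fiber l i `&` [set x | b x] else fiber l i `\` [set x | b x].
  apply/seteqP; split => x.
    by case=> + <-; case: c => bx; split => //=; rewrite bx.
  case: c => [[lx bx]|[lx /= nbx]]; rewrite /fiber /= (lx : l x = i).
    by rewrite (bx : b x).
  by case: (b x) nbx.
have mm : matching (fun x => (b x, l x)) (fun x => (b' x, l' x)).
  case=> c i; have [c1 c2 e] := ll' i; have [cE ED eE _] := hE i.
  have cI := clopenI c1 cb; have cM := clopen_setD c1 cb.
  rewrite fib fib'; case: c; split => //; first exact: clopen_setD.
  rewrite [RHS]kvalD // eE -e -kvalD //.
  by rewrite setDIr setDv set0U.
exists b'; split => // S eS; set W := _ @^-1` S in eS *.
have nonempty c i : fiber (fun x => (b x, l x)) (c, i) !=set0 <->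
    fiber (fun x => (b' x, l' x)) (c, i) !=set0.
  have [c1 c2 e] := mm (c, i).
  split=> /set0P n0; apply/set0P; apply: contraNneq n0 => f0.
    by apply/eqP/(kval_eq0 hK c1); rewrite e f0 kval0.
  by apply/eqP/(kval_eq0 hK c2); rewrite -e f0 kval0.
pose S0 := [set i | exists c, S (c, i) /\ fiber (fun x =>
  (b x, l x)) (c, i) !=set0].
have S0_all i c : S0 i -> fiber (fun x => (b x, l x)) (c, i) !=set0 -> S (c, i).
  move=> [d [Sdi fdi]] fci; have [->//|cd] := eqVneq c d.
  have [I0 M0] : fiber l i `&` [set x | b x] !=set0 /\
                 fiber l i `\` [set x | b x] !=set0.
    by move: fci fdi cd; rewrite !fib; case: (c); case: (d).
  have [_ _ _ /(_ I0 M0)[x [y [Ex [ly nEy] lxy bxy]]]] := hE i.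
  have x_in : (b' x, l' x) = (true, i).
    by have : fiber (fun x => (b' x, l' x)) (true, i) x by rewrite fib'.
  have y_in : (b' y, l' y) = (false, i).
    by have : fiber (fun x => (b' x, l' x)) (false, i) y by rewrite fib'.
  have WE z : W z = S (b' z, l' z) by have := congr1 (@^~ z) eS.
  have Wxy : W x = W y by rewrite /W /preimage /= lxy bxy.
  move: Wxy cd Sdi; rewrite !WE x_in y_in => Sxy.
  by case: (c); case: (d); rewrite // Sxy.
have W1 : W = l @^-1` S0.
  apply/seteqP; split => x; first by move=> Wx; exists (b x); split => //;
    exists x.
  by move=> S0x; apply: (S0_all (l x) (b x)) => //; exists x.
have W2 : W = l' @^-1` S0.
  rewrite eS; apply/seteqP; split => x.
    by move=> Sx; exists (b' x); split => //; apply/nonempty; exists x.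
  by move=> S0x; apply: (S0_all (l' x) (b' x)) => //; apply/nonempty; exists x.
by rewrite W1; apply: lk; rewrite -W1.
Qed.

Lemma matching_nonempty L (l l' : X -> L) i :
  matching l l' -> fiber l i !=set0 -> fiber l' i !=set0.
Proof.
move=> ll' /set0P n0; have [c1 c2 e] := ll' i; apply/set0P.
by apply: contraNneq n0 => f0; apply/eqP/(kval_eq0 hK c1); rewrite e f0 kval0.
Qed.

Section LimitHomeo.
Variables (L : countType) (l l' : nat -> X -> L).
Hypothesis l_match : forall n, matching (l n) (l' n).
Hypothesis l_coarser : forall n x y, l n.+1 x = l' n.+1 y -> l n x = l' n y.
Hypothesis l'_code : forall n x y, l' n x = l' n y ->
  forall k, (k < n)%N -> code x k = code y k.

Lemma limit_point x : exists y, forall n, l' n y = l n x.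
Proof.
apply: contrapT => no_y.
have cl' n : clopen (fiber (l' n) (l n x)) by have [] := l_match n (l n x).
have [|||n hn] := compact_chain (O := fun n =>
  ~` fiber (l' n) (l n x)) (coding_compact hC).
- by move=> n; have [_ /closed_openC] := cl' n.
- move=> n y; apply: contra_not; rewrite /fiber /= => e.
  by apply/esym/l_coarser.
- move=> y _; apply: contrapT => ny; apply: no_y; exists y => n.
  by apply: contrapT => ne; apply: ny; exists n.
have [|y yn] := matching_nonempty (i := l n x) (l_match n); first by exists x.
exact: hn y I yn.
Qed.

Lemma limit_preimage (h : X -> X) A n : (forall x n, l' n (h x) = l n x) ->
  determined code n A -> h @^-1` A = l n @^-1` [set l' n y | y in A].
Proof.
move=> hl dA; apply/seteqP; split => x; first by move=> Ax; exists (h x).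
by case=> y Ay; rewrite -hl => /l'_code e; apply: dA Ay => k kn; rewrite e.
Qed.

Lemma limit_continuous (h : X -> X) : (forall x n, l' n (h x) = l n x) ->
  continuous h.
Proof.
move=> hl; apply/continuousP => U oU.
have [eU cU] := open_bigcup_clopen hC oU; rewrite eU preimage_bigcup.
apply: bigcup_open => n _; have [m dm] := clopen_determined hC (cU n).
rewrite (limit_preimage hl dm); apply: proj1.
by apply: labels_clopen => i; have [] := l_match m i.
Qed.
End LimitHomeo.

Lemma limit_homeo (L : countType) (l l' : nat -> X -> L) :
    (forall n, matching (l n) (l' n)) -> (forall n, linked (l n) (l' n)) ->
    (forall n x y, l n.+1 x = l' n.+1 y -> l n x = l' n y) ->
    (forall n x y, l n x = l n y -> forall k, (k < n)%N ->
      code x k = code y k) ->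
    (forall n x y, l' n x = l' n y -> forall k, (k < n)%N ->
      code x k = code y k) ->
  exists2 h : GK K, GKstar K h & forall n x, l' n (h x) = l n x.
Proof.
move=> ll' lk coarser l_code l'_code.
have ll'_sym n : matching (l' n) (l n) by exact: matching_sym.
have coarser_sym n x y : l' n.+1 x = l n.+1 y -> l' n x = l n y.
  by move=> e; apply/esym/coarser.
have /choice[h hl] := limit_point ll' coarser.
have /choice[h' hl'] := limit_point ll'_sym coarser_sym.
have hK' : cancel h' h.
  by move=> y; apply: (coding_inj hC) => k; apply: (l'_code k.+1) => //;
    rewrite hl hl'.
have h'K : cancel h h'.
  by move=> x; apply: (coding_inj hC) => k; apply: (l_code k.+1) => //;
    rewrite hl' hl.
have ch : continuous h by exact: (@limit_continuous _ l l' ll' l'_code h hl).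
have ch' : continuous h' by exact: (@limit_continuous _ l' l ll'_sym l_code h'
  hl').
have h_homeo : homeomorphism h by split => //; exists h'.
have h_inv mu : K mu -> invariant_measure mu h.
  move=> Kmu; apply: (clopen_invariant hC ch) => A cA.
  have [n dA] := clopen_determined hC cA.
  rewrite (limit_preimage (l := l) l'_code hl dA).
  have := congr1 (@^~ (SigSub (mem_set Kmu) : K)) (labels_kval [set l' n y | y
    in A] (ll' n)).
  rewrite /kval set_valK => ->; congr mass.
  apply/seteqP; split => [x [y Ay /l'_code e]|x Ax]; last by exists x.
  by apply: dA Ay => k kn; rewrite e.
exists (MkGK h_homeo h_inv); last by move=> n x; exact: hl.
move=> U cU U0 UT /= hU; have [n dU] := clopen_determined hC cU.
have lU : l n @^-1` [set l n x | x in U] = U.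
  apply/seteqP; split => [x [y Uy /l_code e]|x Ux]; last by exists x.
  by apply: dU Uy => k kn; rewrite e.
have l'U : l' n @^-1` [set l n x | x in U] = U.
  apply/seteqP; split => [y [x Ux]|y]; last first.
    by rewrite -{1}hU => -[x Ux <-]; exists x => //; rewrite hl.
  rewrite -hl => /l'_code e; have : U (h x) by rewrite -hU; exists x.
  by move=> Uhx; apply: dU Uhx => k kn; rewrite e.
have [] := lk n [set l n x | x in U]; first by rewrite lU l'U.
  by rewrite lU => e; move: U0; rewrite e => -[].
by rewrite lU.
Qed.

Lemma matching_relabel (L L' : Type) (f : L -> L') (l l' : X -> L) :
  injective f -> matching l l' -> matching (f \o l) (f \o l').
Proof.
move=> fI ll' j; have [[i <-]|nj] := pselect (exists i, f i = j).
  have fE (k : X -> L) : fiber (f \o k) (f i) = fiber k i.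
    by apply/seteqP; split => x; [move/fI | move=> /= <-].
  by rewrite !fE.
have fE (k : X -> L) : fiber (f \o k) j = set0.
  by apply/seteqP; split => // x kx; apply: nj; exists (k x).
by rewrite !fE; split => //; exact: clopen0.
Qed.

Lemma linked_relabel (L L' : Type) (f : L -> L') (l l' : X -> L) :
  linked l l' -> linked (f \o l) (f \o l').
Proof. by move=> lk S; apply: (lk (f @^-1` S)). Qed.

(** Coordinates are added alternately to the labels of both sides, by refining
   the partial isomorphism and its inverse.  In the limit labels determine
   points; a clopen set fixed by the limit is a union of atoms of some stage,
   hence trivial since all stages are linked. *)
Theorem linked_extension (L : countType) (l l' : X -> L) :
    matching l l' -> linked l l' ->
  exists2 h : GK K, GKstar K h & forall x, l' (h x) = l x.
Proof.
move=> ll' lk; pose T := (seq bool * L)%type.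
pose good (p : (X -> T) * (X -> T)) := matching p.1 p.2 /\ linked p.1 p.2.
pose push b (i : T) : T := (b :: i.1, i.2).
have push_inj b c i j : push b i = push c j -> b = c /\ i = j.
  by case: i j => [s i] [t j] [-> -> ->].
have refine (p : (X -> T) * (X -> T)) (b : X -> bool) : good p ->
  clopen [set x | b x] ->
    exists b', good (fun x => push (b x) (p.1 x), fun x => push (b' x) (p.2 x)).
  move=> [pm pl] cb; have [b' [bm bl]] := matching_refine pm pl cb; exists b'.
  have inj : injective (fun q : bool * T => push q.1 q.2).
    by move=> [c i] [d j] /= /push_inj[-> ->].
  by split; [exact: (matching_relabel inj bm) | exact: (@linked_relabel _ _
    (fun q : bool * T => push q.1 q.2) _ _ bl)].
have good_sym p : good p -> good (p.2, p.1).
  by move=> [pm pl]; split; [exact: matching_sym | exact: linked_sym].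
pose next n (p q : (X -> T) * (X -> T)) := exists b b',
  (forall x, q.1 x = push (b x) (push (code x n) (p.1 x))) /\
  (forall x, q.2 x = push (code x n) (push (b' x) (p.2 x))).
have /choice[F hF] (np : nat * ((X -> T) * (X -> T))) :
    exists q, good np.2 -> good q /\ next np.1 np.2 q.
  case: np => n p /=; have [gp|ngp] := pselect (good p); last by exists p.
  have [b' gb'] := refine p (code^~ n) gp (coding_clopen hC n).
  have [b gb] := refine _ (code^~ n) (good_sym _ gb') (coding_clopen hC n).
  exists (fun x => push (b x) (push (code x n) (p.1 x)),
          fun x => push (code x n) (push (b' x) (p.2 x))) => _.
  by split; [exact: good_sym gb | exists b, b'].
pose s := fix s n := if n is m.+1 then F (m, s m) else
  ((fun x => ([::], l x)), (fun x => ([::], l' x))) : (X -> T) * (X -> T).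
have good_s n : good (s n).
  elim: n => [|n IH] /=; last by have [] := hF (n, s n) IH.
  have inj : injective (fun i : L => ([::], i) : T) by move=> i j [].
  by split; [exact: (matching_relabel inj ll') | exact: (@linked_relabel _ _
    (fun i : L => ([::], i) : T) _ _ lk)].
have next_s n : next n (s n) (s n.+1) by have [] := hF (n, s n) (good_s n).
have s_code n x y : ((s n).1 x = (s n).1 y -> forall k, (k < n)%N ->
  code x k = code y k) /\
    ((s n).2 x = (s n).2 y -> forall k, (k < n)%N -> code x k = code y k).
  elim: n => [|n [IH1 IH2]] //; have [b [b' [s1 s2]]] := next_s n.
  split; rewrite ?s1 ?s2 => /push_inj[e /push_inj[e' es]] k;
    by rewrite ltnS leq_eqVlt => /orP[/eqP -> //|]; (exact: IH1 || exact: IH2).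
have coarser n x y : (s n.+1).1 x = (s n.+1).2 y -> (s n).1 x = (s n).2 y.
  by have [b [b' [-> ->]]] := next_s n; move=> /push_inj[_ /push_inj[]].
have [h hg hs] := limit_homeo (fun n => (good_s n).1) (fun n => (good_s n).2)
  coarser (fun n x y => (s_code n x y).1) (fun n x y => (s_code n x y).2).
by exists h => // x; have [] := hs 0%N x.
Qed.
End Limits.

(** * Density *)

Section Density.
Variables (X : ptopologicalType) (R : realType) (K : set (bprob X R)).
Hypothesis hK : dynamical_simplex K.
Variable code : X -> nat -> bool.
Hypothesis hC : coding code.
Implicit Types (A B C U : set X).
Local Notation bits := (bits code).

Lemma clopen_partition_along (T : eqType) (t0 : T) (s : seq T)
    (v : T -> K -> R) U :
    uniq s -> clopen U -> (forall t, t \in s -> clopen_val K (v t)) ->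
    kval K U = \sum_(t <- s) v t ->
  exists pos : X -> T, (forall x, U x -> pos x \in s) /\
    forall t, t \in s -> clopen (U `&` [set x | pos x = t]) /\
                         kval K (U `&` [set x | pos x = t]) = v t.
Proof.
elim: s U => [|t s IH] U /=.
  move=> _ cU _; rewrite big_nil => /(kval_eq0 hK cU) ->.
  by exists (fun=> t0); split.
move=> /andP[ts us] cU hv; rewrite big_cons => Ue.
have [B cB vB] := hv t (mem_head t s).
have hvs t' : t' \in s -> clopen_val K (v t') by move=> ts'; apply: hv;
  rewrite inE ts' orbT.
have [|C [cC CU CB]] := kval_embed hK cB cU.
  rewrite Ue vB addrC addKr; apply: (scale_pos_sum (clopen_val_scale hK hC))
    => t' ts' _.
  exact: (rs_pos (clopen_val_scale hK hC) (hvs _ ts')).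
have cUC := clopen_setD cU cC.
have [|pos [pos_s hpos]] := IH _ us cUC hvs.
  by rewrite kvalD // CB Ue vB addrC addKr.
pose pos' x := if `[< C x >] then t else pos x.
have posC x : C x -> pos' x = t by move=> Cx; rewrite /pos' asboolT.
have posD x : ~ C x -> pos' x = pos x by move=> Cx; rewrite /pos' asboolF.
exists pos'; split.
  move=> x Ux; have [Cx|nCx] := pselect (C x);
    first by rewrite posC // mem_head.
  by rewrite posD // inE pos_s ?orbT.
move=> t'; rewrite inE => /orP[/eqP ->|ts'].
  have -> : U `&` [set x | pos' x = t] = C.
    apply/seteqP; split => [x [Ux /= e]|x Cx]; last by split;
      [exact: CU | exact: posC].
    apply: contrapT => nCx; move: ts; rewrite -e posD // pos_s //.
  by rewrite CB vB.
suff -> : U `&` [set x | pos' x = t'] = (U `\` C) `&` [set x | pos x = t'] by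
  exact: hpos.
apply/seteqP; split => [x [Ux /= e]|x [[Ux nCx] /= e]]; last by split => //=;
  rewrite posD.
have nCx : ~ C x by move=> Cx; move: ts; rewrite -(posC x Cx) e ts'.
by split; [split | rewrite /= -e posD].
Qed.

Definition balanced_KR (f : X -> X) A B : Prop :=
  exists (I : finType) (n : I -> nat) (C : I -> nat -> set X),
    [/\ KR_partition f n C, union_of_atoms n C A, union_of_atoms n C B &
        forall i, atom_count n C i A = atom_count n C i B].

Section Perturbation.
Variable g : GK K.
Hypothesis g_star : GKstar K g.
Variables (A B : set X) (n : nat).
Hypotheses (dA : determined code n A) (dB : determined code n B).
Hypothesis AB : kval K A = kval K B.

Lemma GK_inverse : exists gi : X ->
  X, [/\ continuous gi, cancel g gi & cancel gi g].
Proof. by have [_] := GK_homeo g. Qed.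

Lemma GK_image_clopen U : clopen U -> clopen (g @` U).
Proof.
have [gi [cgi gK giK]] := GK_inverse => cU.
have -> : g @` U = gi @^-1` U.
  apply/seteqP; split => [_ [x Ux <-]|y Uy]; first by rewrite /preimage /= gK.
  by exists (gi y).
exact: preimage_clopen.
Qed.

Lemma GK_image_mass (mu : bprob X R) U : invariant_measure mu g -> clopen U ->
  mass mu (g @` U) = mass mu U.
Proof.
move=> g_mu cU; have [gi [_ gK _]] := GK_inverse.
have e : g @^-1` (g @` U) = U.
  by apply/seteqP; split => [x [y Uy /(can_inj gK) <-]//|x Ux]; exists x.
by rewrite -(invariant_mass g_mu (GK_image_clopen cU)) e.
Qed.

Lemma GK_image_kval U : clopen U -> kval K (g @` U) = kval K U.
Proof.
move=> cU; apply/funext => mu; apply: GK_image_mass => //.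
exact: GK_inv (set_valP mu).
Qed.

Local Notation W := {ffun 'I_n -> bool}.

(** A point is labelled by the cylinder from which it comes under [g] and the one
   in which it lies.  The values of these steps form a circulation because [g]
   preserves values.  The cylinders that can be reached from a given one form a
   set that [g] maps into itself, hence onto itself by full support; as [g]
   belongs to [GKstar K], all cylinders are reached. *)
Lemma step_data : exists gi : X -> X, [/\ cancel g gi, cancel gi g &
  let el x := (bits n (gi x), bits n x) in
  let m e := kval K [set x | el x = e] in
  [/\ forall e, clopen [set x | el x = e],
      \sum_e m e = kval K setT,
      forall v, \sum_a m (v, a) = \sum_c m (c, v) &
      forall a b, connect (fun c d => m (c, d) != 0) a b]].
Proof.
have [gi [cgi gK giK]] := GK_inverse; exists gi; split => //=.
set el := fun x => (bits n (gi x), bits n x).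
set m := fun e => kval K [set x | el x = e].
have c1 (a : W) : clopen [set x | bits n x = a] by exact: bits_clopen hC n a.
have c2 (a : W) : clopen [set x | bits n (gi x) = a].
  exact: (preimage_clopen (f := gi) (c1 a) cgi).
have elE c a : [set x | el x = (c, a)] =
    [set x | bits n (gi x) = c] `&` [set x | bits n x = a].
  by apply/seteqP; split => [x [<- <-]|x [/= <- <-]].
have cel e : clopen [set x | el x = e] by case: e => c a; rewrite elE;
  exact: clopenI.
have out_m v : \sum_a m (v, a) = kval K [set x | bits n x = v].
  transitivity (kval K [set x | bits n (gi x) = v]).
    rewrite (kval_fibers K (p := bits n) (c2 v)) //.
    by apply: eq_bigr => a _; rewrite /m elE.
  rewrite -(GK_image_kval (c1 v)); congr kval.
  apply/seteqP; split => [x /= <-|_ [x /= <- <-]]; last by rewrite gK.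
  by exists (gi x).
have in_m v : \sum_c m (c, v) = kval K [set x | bits n x = v].
  rewrite (kval_fibers K (p := fun x => bits n (gi x)) (c1 v)) //.
  by apply: eq_bigr => a _; rewrite /m elE setIC.
split => //.
- rewrite (kval_fibers K (p := el) clopenT) //.
  by apply: eq_bigr => e _; rewrite setTI.
- by move=> v; rewrite out_m in_m.
- move=> a b; pose r c d := m (c, d) != 0.
  pose U := [set x | connect r a (bits n x)].
  have cU : clopen U by exact: (labels_clopen (l :=
    bits n) [set v | connect r a v]).
  have gU : g @` U `<=` U.
    move=> _ [x Ux <-]; apply: connect_trans Ux (connect1 _); rewrite /r /m.
    apply/eqP => /(kval_eq0 hK (cel _)); apply/eqP/set0P; exists (g x).
    by rewrite /= /el gK.
  have gUU : g @` U = U.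
    apply/seteqP; split => // x Ux; apply: contrapT => ngx.
    have cD := clopen_setD cU (GK_image_clopen cU).
    have : kval K (U `\` g @` U) = 0.
      by rewrite kvalD //; [rewrite GK_image_kval // subrr | exact:
        GK_image_clopen].
    move/(kval_eq0 hK cD) => D0; have : (U `\` g @` U) x by split.
    by rewrite D0.
  have bits_onto (v : W) : exists x, bits n x = v.
    have [x xv] := coding_surj hC (fun k =>
      if insub k is Some i then v i else false).
    by exists x; apply/ffunP => i; rewrite ffunE xv valK.
  have [x xa] := bits_onto a; have [y yb] := bits_onto b.
  have [UT|UT] := pselect (U = setT).
    by rewrite -yb; have : U y by rewrite UT.
  by case: (g_star cU _ UT gUU); exists x; rewrite /U /= xa.
Qed.

Definition hits U (a : W) : bool := `[< exists2 x, U x & bits n x = a >].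

Lemma hitsE U x : determined code n U -> hits U (bits n x) = `[< U x >].
Proof.
move=> dU; apply/asboolP/asboolP => [[y Uy /bitsP yx]|Ux]; last by exists x.
exact: dU yx Uy.
Qed.

Lemma weight_steps (c : W) (ws : seq W) :
  weight (@step_count W) (fun e => (hits A e.2)%:Z - (hits B e.2)%:Z) (c, ws) =
  (count (hits A) ws)%:Z - (count (hits B) ws)%:Z.
Proof.
set w := fun e : W * W => _.
have -> : weight (@step_count W) w (c, ws) = \sum_(e <- steps (c, ws)) w e.
  rewrite /weight /step_count; elim: (steps _) => [|e s IH].
    by rewrite big_nil big1 // => e _; rewrite mulr0n.
  rewrite big_cons -IH (eq_bigr (fun f =>
    w f *+ (e == f) + w f *+ count_mem f s)).
    rewrite big_split /= (bigD1 e) //= eqxx mulr1n big1 ?addr0 // => f fe.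
    by rewrite eq_sym (negPf fe).
  by move=> f _ /=; rewrite mulrnDr.
rewrite /steps /=; elim: ws c => [|a ws IH] c /=; first by rewrite big_nil.
by rewrite big_cons IH /w /= !PoszD opprD addrACA.
Qed.

(** The balanced walks are realized by clopen sets, the pieces of each step being
   shared out among the columns.  The point [x] lies in the level [(pos x).2] of
   the column [(pos x).1]; the walk of the column [i] starts at [a0], and [w i]
   lists the vertices that it visits afterwards. *)
Lemma columns_exist : exists (gi : X -> X) (a0 : W) (N : nat) (w : nat -> seq W)
    (v : nat -> K -> R) (pos : X -> nat * nat),
  [/\ cancel g gi /\ cancel gi g,
    forall i, (i < N)%N -> [/\ (0 < size (w i))%N, last a0 (w i) = a0 &
                        count (hits A) (w i) = count (hits B) (w i)],
    forall x, ((pos x).1 < N)%N /\ ((pos x).2 < size (w (pos x).1))%N,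
    forall x, bits n (gi x) = nth a0 (a0 :: w (pos x).1) (pos x).2 /\
              bits n x = nth a0 (w (pos x).1) (pos x).2 &
    forall i k, (i < N)%N -> (k < size (w i))%N ->
      [/\ clopen (fiber pos (i, k)), kval K (fiber pos (i, k)) = v i &
          fiber pos (i, k) !=set0]].
Proof.
have [gi [gK giK]] := step_data.
set el := fun x => (bits n (gi x), bits n x).
set m := fun e => kval K [set x | el x = e].
move=> [cel m_sum m_flow m_conn].
have hV := clopen_val_scale hK hC.
have m_val e : clopen_val K (m e) by exists [set x | el x = e].
pose wt (e : W * W) : int := (hits A e.2)%:Z - (hits B e.2)%:Z.
have sum_meets U : clopen U -> determined code n U ->
    \sum_e m e *~ (hits U e.2)%:Z = kval K U.
  move=> cU dU; rewrite (kval_fibers K (p := el) cU) //; apply: eq_bigr => e _.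
  rewrite -pmulrn; case: (boolP (hits U e.2)) => [/asboolP Ue|/asboolP Ue].
    rewrite mulr1n; congr kval; apply/seteqP; split => [x ex|x []//];
      split => //.
    have [y Uy ye] := Ue; move: ye; rewrite -(ex : el x = e) /= => /bitsP yx.
    exact: dU yx Uy.
  rewrite mulr0n (_ : _ `&` _ = set0) ?kval0 //; apply/seteqP;
    split => // x [Ux ex].
  by apply: Ue; exists x => //; rewrite -(ex : el x = e).
have wt0 : \sum_e m e *~ wt e = 0.
  under eq_bigr do rewrite mulrzBr.
  rewrite sumrB !sum_meets ?AB ?subrr //.
  - exact: (determined_clopen hC dB).
  - exact: (determined_clopen hC dA).
have T0 : kval K setT != 0.
  by apply/eqP => /(kval_eq0 hK clopenT) T0; have : [set: X] point by [];
    rewrite T0.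
pose a0 : W := bits n point.
have [S [hS S_neq0 S_closed]] :=
  balanced_walks hV m_val m_sum m_flow m_conn T0 a0 wt0.
pose d0 : (K -> R) * (W * seq W) := (0, (a0, [::])).
pose w i := (nth d0 S i).2.2; pose v i := (nth d0 S i).1.
have S_nth i : (i < size S)%N -> nth d0 S i \in S by exact: mem_nth.
pose allpos := [seq (i, k) | i <- iota 0 (size S), k <- iota 0 (size (w i))].
have mem_allpos i k : ((i, k) \in allpos) = (i < size S)%N && (k < size (w
  i))%N.
  apply/allpairsPdep/andP => [[j [l [+ + [-> ->]]]]|[iN kw]];
    first by rewrite !mem_iota.
  by exists i, k; rewrite !mem_iota.
have uniq_allpos : uniq allpos.
  apply: allpairs_uniq_dep => [|i _|[i k] [j l] _ _ /= [-> ->]] //;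
    exact: iota_uniq.
pose letter (q : nat * nat) := nth (a0, a0) (steps (a0, w q.1)) q.2.
have v_val i : (i < size S)%N -> clopen_val K (v i) by move=> /S_nth /hS.1[].
have sum_letter e : m e = \sum_(q <- [seq q <- allpos | letter q == e]) v q.1.
  rewrite -hS.2 [RHS]big_filter [RHS]big_mkcond [RHS]big_allpairs_dep (big_nth
    d0) /= big_mkord.
  rewrite -[in RHS](subn0 (size S)) -/(index_iota 0 (size S)) big_mkord.
  apply: eq_bigr => i _; rewrite -/(v i).
  have Si : (nth d0 S i).2 = (a0, w i).
    by have [<- _ _] := S_closed _ (S_nth i (ltn_ord i));
      rewrite -surjective_pairing.
  rewrite Si /step_count -sum1_count big_mkcond (big_nth (a0, a0)) big_mkord.
  rewrite size_pairmap -[in RHS](subn0 (size _)) -/(index_iota 0 _) big_mkord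
    -sumrMnr.
  by apply: eq_bigr => k _; rewrite /letter /=; case: eqP;
    rewrite ?mulr1n ?mulr0n.
have /choice[P hP] (e : W * W) : exists pos : X -> nat * nat,
    (forall x, el x = e -> pos x \in [seq q <- allpos | letter q == e]) /\
    forall q, q \in [seq q <- allpos | letter q == e] ->
      clopen ([set x | el x = e] `&` [set x | pos x = q]) /\
      kval K ([set x | el x = e] `&` [set x | pos x = q]) = v q.1.
  apply: (clopen_partition_along (0, 0)%N _ (cel e)).
  - exact: filter_uniq.
  - by case=> i k; rewrite mem_filter mem_allpos => /and3P[_ /v_val].
  - exact: sum_letter.
pose pos x := P (el x) x.
have pos_all x : pos x \in allpos /\ letter (pos x) = el x.
  have := (hP (el x)).1 x erefl; rewrite mem_filter -/(pos x).
  by move=> /andP[/eqP].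
have fiber_pos q : q \in allpos ->
    fiber pos q = [set x | el x = letter q] `&` [set x | P (letter q) x = q].
  move=> _; apply/seteqP; split => [x xq|x [xq /= Pxq]]; last first.
    by rewrite /fiber /= /pos (xq : el x = letter q).
  have [_] := pos_all x; rewrite (xq : pos x = q) => lx; split => //=.
  by rewrite lx.
exists gi, a0, (size S), w, v, pos; split => //.
- move=> i iN; have [_ closed_i wt_i] := S_closed _ (S_nth i iN).
  have [start_i _ _] := S_closed _ (S_nth i iN).
  split.
  + by rewrite -(wsize_walk (nth d0 S i).2); have [] := hS.1 _ (S_nth i iN).
  + by move: closed_i; rewrite start_i.
  + move: wt_i; rewrite (surjective_pairing (nth d0 S i).2) weight_steps =>
    /eqP.
    by rewrite subr_eq0 => /eqP[].
- by move=> x; have [] := pos_all x; case: (pos x) => i k;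
  rewrite mem_allpos => /andP[].
- move=> x; have [] := pos_all x; case: (pos x) => i k;
  rewrite mem_allpos /letter /=.
  move=> /andP[_ kw]; rewrite (nth_pairmap a0) // /el => -[-> ->].
  by [].
- move=> i k iN kw; have q_in : (i, k) \in allpos by rewrite mem_allpos iN.
  have [_ /(_ (i, k))] := hP (letter (i, k)).
  rewrite mem_filter eqxx q_in -fiber_pos // => /(_ isT)[cq vq]; split => //.
  apply/set0P/eqP => q0; move: vq; rewrite q0 kval0 => /esym/eqP.
  by apply/negP; exact: S_neq0 _ (S_nth i iN).
Qed.

(** The partial isomorphism sending each level to the next one, and the union of
   the tops to the union of the bases, is linked: a union of its atoms that is
   sent to itself contains, or misses, whole columns, and contains all the tops
   or none.  Its extension agrees with [g] on cylinders of length [n], since a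
   level and its image lie in consecutive cylinders of a walk. *)
Lemma balanced_perturbation : exists h : GK K, [/\ GKstar K h,
  forall U, determined code n U -> h @` U = g @` U & balanced_KR h A B].
Proof.
have [gi [a0 [N [w [v [pos [[gK giK] hw pos_in pos_bits hpos]]]]]]] :=
  columns_exist.
pose top (q : nat * nat) := q.2.+1 == size (w q.1).
pose next (q : nat * nat) := if top q then None else Some q.
pose prev (q : nat * nat) := if q.2 == 0%N then None else Some (q.1, q.2.-1).
pose l x := next (pos x); pose l' x := prev (pos x).
have cpos q : clopen (fiber pos q).
  case: q => i k; have [/andP[iN kw]|ninv] :=
    boolP ((i < N)%N && (k < size (w i))%N).
    by have [] := hpos i k iN kw.
  suff -> : fiber pos (i, k) = set0 by exact: clopen0.
  apply/seteqP; split => // x xq; move/negP: ninv; apply.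
  by have := pos_in x; rewrite (xq : pos x = (i, k)) => -[/= -> ->].
have cl i : clopen (fiber l i) by exact: (labels_clopen (l :=
  pos) (next @^-1` [set i])).
have cl' i : clopen (fiber l' i) by exact: (labels_clopen (l :=
  pos) (prev @^-1` [set i])).
have sum_levels (s : seq nat) (k : nat -> nat) : uniq s ->
    {subset s <= iota 0 N} -> (forall i, (i < N)%N -> (k i < size (w i))%N) ->
    kval K [set x | pos x \in [seq (i, k i) | i <- s]] = \sum_(i <- s) v i.
  move=> us sN hk; rewrite (kval_fibers_seq K (p := pos)) //; last first.
    by rewrite map_inj_uniq // => i j [].
  rewrite big_map [LHS]big_seq [RHS]big_seq; apply: eq_bigr => i /sN.
  by rewrite mem_iota /= => iN; have [] := hpos i (k i) iN (hk i iN).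
have ll' : matching K l l'.
  case=> [[i k]|]; split => //.
    have lE : fiber l (Some (i, k)) =
        if (i < N)%N && (k.+1 < size (w i))%N then fiber pos (i, k) else set0.
      apply/seteqP; split => x.
        rewrite /fiber /= /l /next; have := pos_in x;
          case px: (pos x) => [j m] [/= jN mj].
        rewrite /top /=; case: eqP => // /eqP mt [<- <-].
        by rewrite jN ltn_neqAle mt mj.
      case: ifP => // /andP[iN kw] xq;
        rewrite /fiber /= /l (xq : pos x = (i, k)).
      by rewrite /next /top /= (ltn_eqF kw).
    have l'E : fiber l' (Some (i, k)) =
        if (i < N)%N && (k.+1 < size (w i))%N then fiber pos (i, k.+1)
        else set0.
      apply/seteqP; split => x.
        rewrite /fiber /= /l' /prev; have := pos_in x;
          case px: (pos x) => [j [|m]] [/= jN mj] //.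
        by move=> [<- <-]; rewrite jN mj.
      case: ifP => // /andP[iN kw] xq;
        rewrite /fiber /= /l' (xq : pos x = (i, k.+1)).
      by [].
    rewrite lE l'E; case: ifP => // /andP[iN kw].
    have [_ -> _] := hpos i k iN (ltnW kw).
    by have [_ -> _] := hpos i k.+1 iN kw.
  have -> : fiber l None =
      [set x | pos x \in [seq (i, (size (w i)).-1) | i <- iota 0 N]].
    apply/seteqP; split => x; rewrite /fiber /= /l /next.
      have := pos_in x; case: (pos x) => i k [/= iN ki]; case: ifP => // ti _.
      apply/mapP; exists i; first by rewrite mem_iota.
      by rewrite -(eqP (ti : k.+1 == size (w i))).
    case/mapP => i; rewrite mem_iota /= => iN ->; rewrite /top /=.
    by have [s0 _ _] := hw i iN; rewrite prednK // eqxx.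
  have -> : fiber l' None = [set x | pos x \in [seq (i, 0%N) | i <- iota 0 N]].
    apply/seteqP; split => x; rewrite /fiber /= /l' /prev.
      have := pos_in x; case: (pos x) => i [|k] [/= iN ki] // _.
      by apply/mapP; exists i => //; rewrite mem_iota.
    by case/mapP => i _ ->.
  rewrite (sum_levels _ (fun i => (size (w i)).-1)) ?iota_uniq //; last first.
    by move=> i /hw[s0 _ _]; rewrite prednK.
  by rewrite (sum_levels _ (fun i => 0%N)) ?iota_uniq // => i /hw[].
have lk : linked l l'.
  have key (S : set (option (nat * nat))) : S None ->
    l @^-1` S = l' @^-1` S -> l @^-1` S = setT.
    move=> SN e; apply/seteqP; split => // x _.
    have [m] := ubnP (size (w (pos x).1) - (pos x).2)%N.
    elim: m x => // m IH x; rewrite ltnS => xm.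
    rewrite /preimage /= /l /next; case: ifP => // /eqP nt.
    have [iN kw] := pos_in x; have kw' : ((pos x).2.+1 < size (w (pos x).1))%N.
      by rewrite ltn_neqAle kw andbT; apply/eqP.
    have [_ _ [y yq]] := hpos _ _ iN kw'.
    have : (l' @^-1` S) y.
      by rewrite -e; apply: IH; rewrite (yq : pos y = _) /=; lia.
    by rewrite /preimage /= /l' (yq : pos y = _) /prev /= -surjective_pairing.
  move=> S e; have [SN|SN] := pselect (S None); first by right; exact: key.
  left; have := key (~` S) SN; rewrite -!preimage_setC e => /(_ erefl).
  by move=> eT; rewrite -(setCK (l' @^-1` S)) eT setCT.
have [h h_star hl] := linked_extension hK hC ll' lk.
have [hi [_ hK' hiK]] : exists hi : X ->
  X, [/\ continuous hi, cancel h hi & cancel hi h].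
  by have [_] := GK_homeo h.
have h_next x : ~~ top (pos x) -> pos (h x) = ((pos x).1, (pos x).2.+1).
  move=> nt; have := hl x; rewrite /l /l' /next /prev (negPf nt).
  by case: (pos (h x)) => i [|k] //= [<-].
have h_top x : top (pos x) -> (pos (h x)).2 = 0%N.
  move=> t; have := hl x; rewrite /l /l' /next /prev t.
  by case: (pos (h x)) => i [|k].
have h_bits x : bits n (gi (h x)) = bits n x.
  have [-> _] := pos_bits (h x); have [_ ->] := pos_bits x.
  have [t|nt] := boolP (top (pos x)); last by rewrite (h_next x nt).
  rewrite (h_top x t) /=; have [iN _] := pos_in x;
    have [s0 last_a0 _] := hw _ iN.
  by rewrite -[LHS]last_a0 -nth_last -(eqP t : (pos x).2.+1 = _).
exists h; split => //.
  move=> U dU; apply/seteqP; split => [_ [x Ux <-]|_ [x Ux <-]].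
    exists (gi (h x)); last exact: giK.
    by apply: dU Ux; apply/bitsP; rewrite h_bits.
  exists (hi (g x)); last exact: hiK.
  by apply: dU Ux; apply/bitsP; rewrite -(h_bits (hi (g x))) hiK gK.
have pos_valid x i k : pos x = (i, k) -> (i < N)%N /\ (k < size (w i))%N.
  by move=> xq; have := pos_in x; rewrite xq.
have level_sub U i k x : determined code n U -> pos x = (i, k) ->
    `[< fiber pos (i, k) `<=` U >] = hits U (nth a0 (w i) k).
  move=> dU xq; have [_ xa] := pos_bits x; rewrite xq /= in xa.
  rewrite -xa hitsE //; apply/asboolP/asboolP => [sU|Ux y yq]; first exact: sU.
  apply: dU Ux; apply/bitsP; have [_ ->] := pos_bits y.
  by rewrite (yq : pos y = _).
have size_w (i : 'I_N) : (size (w i)).-1.+1 = size (w i).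
  by have [s0 _ _] := hw i (ltn_ord i); rewrite prednK.
pose nn (i : 'I_N) := (size (w i)).-1;
  pose C (i : 'I_N) j := fiber pos (val i, j).
have unions U : determined code n U -> union_of_atoms nn C U.
  move=> dU; exists [set q | KR_index nn q /\ C q.1 q.2 `<=` U] => [q []//|].
  apply/seteqP; split => [x Ux|x [q [_ qU] xq]]; last exact: qU.
  have [iN kw] := pos_in x; exists (Ordinal iN, (pos x).2); last first.
    by rewrite /C /fiber /= -surjective_pairing.
  split; first by rewrite /KR_index /= -ltnS (size_w (Ordinal iN)).
  apply/asboolP; rewrite /C /= (level_sub U _ _ x) //;
    last exact: surjective_pairing.
  by have [_ <-] := pos_bits x; rewrite hitsE //; apply/asboolP.
have atom_countE U i : determined code n U ->
  atom_count nn C i U = count (hits U) (w i).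
  move=> dU; rewrite -sum1_count (big_nth a0) big_mkord -(size_w i).
  rewrite /atom_count -sum1_card; apply: eq_bigl => j; rewrite inE.
  have jw : (j < size (w i))%N by rewrite -size_w.
  have [_ _ [x xq]] := hpos i j (ltn_ord i) jw.
  exact: (level_sub U _ _ x).
exists 'I_N, nn, C; split; [|exact: unions|exact: unions|].
- split.
  + split.
    * apply/seteqP; split => // x _; have [iN kw] := pos_in x.
      exists (Ordinal iN, (pos x).2);
        first by rewrite /KR_index /= -ltnS (size_w (Ordinal iN)).
      by rewrite /C /fiber /= -surjective_pairing.
    * move=> [i j] [i' j'] _ _ [x [xi xj]]; move: xi xj;
      rewrite /C /fiber /= => ->.
      by move=> [/val_inj -> ->].
    * move=> [i j] /=; rewrite /KR_index /= -ltnS (size_w i) => jw.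
      by have [_ _ ne] := hpos i j (ltn_ord i) jw.
  + by move=> i j _; exact: cpos.
  + move=> i j; rewrite /nn -ltnS (size_w i) => jw.
    have ntop : ~~ top (val i, j) by rewrite /top /= neq_ltn jw.
    apply/seteqP; split => [_ [x xq <-]|y yq].
      by rewrite /C /fiber /= h_next (xq : pos x = _).
    exists (hi y); last exact: hiK.
    have := hl (hi y); rewrite hiK /l' /prev (yq : pos y = _) /= /l /next.
    by case: ifP => // _ [e]; rewrite /C /fiber /= e.
- by move=> i; rewrite !atom_countE //; have [_ _ ->] := hw i (ltn_ord i).
Qed.
End Perturbation.
End Density.

(** * Saturated elements are generic *)

Section Genericity.
Variables (X : ptopologicalType) (R : realType) (K : set (bprob X R)).
Hypothesis hK : dynamical_simplex K.
Variable code : X -> nat -> bool.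
Hypothesis hC : coding code.
Implicit Types (A B C U : set X).

Lemma finite_determined (P : set (set X)) : finite_set P ->
  (forall A, P A -> clopen A) -> exists n, forall A, P A -> determined code n A.
Proof.
move=> /finite_seqP[s ->] /= cs.
elim: s cs => [|A s IH] cs; first by exists 0%N.
have [|n hn] := IH; first by move=> B Bs; apply: cs; rewrite /= inE Bs orbT.
have [|m hm] := clopen_determined hC (cs A _); first by rewrite /= inE eqxx.
exists (maxn m n) => B /=; rewrite inE => /orP[/eqP ->|/hn].
  by apply: determined_leq hm; rewrite leq_maxl.
by apply: determined_leq; rewrite leq_maxr.
Qed.

Lemma balanced_KR_open A B : open [set g : GK K | balanced_KR g A B].
Proof.
rewrite openE => g /= [I [n [C [[[Ccov Ctriv Cne] Cclopen Cstep] CA CB cnt]]]].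
pose Idx := [set p : I * nat | (p.2 <= n p.1)%N].
pose P := [set C p.1 p.2 | p in Idx].
have finIdx : finite_set Idx.
  pose m := (\max_i n i).+1.
  apply: (@sub_finite_set _ _ [set (p.1, val p.2) | p in [set: I * 'I_m]]).
    move=> [i j] /= ij; have jm : (j < m)%N.
      by rewrite ltnS; apply: leq_trans ij (leq_bigmax i).
    by exists (i, Ordinal jm).
  by apply: finite_image; exact: finite_finset.
exists P; last first.
  move=> h hg; exists I, n, C; split => //; split => // i j ij.
  by rewrite hg ?Cstep //; exists (i, j) => //; exact: ltnW.
split.
- exact: finite_image.
- split.
  + by rewrite -Ccov /cover /P bigcup_image.
  + by move=> _ _ [p pI <-] [q qI <-] pq; rewrite (Ctriv p q pI qI pq).
  + by move=> _ [p pI <-]; exact: Cne.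
- by move=> _ [[i j] ij <-]; exact: Cclopen.
Qed.

Lemma balanced_KR_dense A B : clopen A -> clopen B -> kval K A = kval K B ->
  dense [set g : GKstar K | balanced_KR (set_val g) A B].
Proof.
move=> cA cB AB O [g Og] [V oV OV].
have Vg : V (set_val g) by have : (set_val @^-1` V) g by rewrite OV.
have [P [finP _ clP] PV] : nbhs (set_val g) V by apply: open_nbhs_nbhs.
have [n1 hP] := finite_determined finP clP.
have [n2 dA] := clopen_determined hC cA;
  have [n3 dB] := clopen_determined hC cB.
pose n := maxn n1 (maxn n2 n3).
have gst : GKstar K (set_val g) by exact: set_valP.
have [||h [h_star h_g h_bal]] :=
  @balanced_perturbation _ _ _ hK _ hC _ gst A B n _ _ AB.
- by apply: determined_leq dA; rewrite /n; lia.
- by apply: determined_leq dB; rewrite /n; lia.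
exists (SigSub (mem_set h_star)); split; last by rewrite /= set_valE.
rewrite -OV /preimage /= set_valE /=; apply: PV => U /hP dU; apply: h_g.
by apply: determined_leq dU; rewrite /n; lia.
Qed.

(** Clopen sets are determined by finitely many coordinates, so that there are
   countably many of them. *)
Lemma comeager_saturated : comeager [set g : GKstar K | saturated (set_val g)].
Proof.
have [e he] : exists e : nat -> set X, forall A, clopen A -> exists k, e k = A.
  pose dec (k : nat) : set X :=
    if (unpickle k : option {n : nat & {set {ffun 'I_n -> bool}}})
      is Some (existT n s)
    then [set x | bits code n x \in s] else set0.
  exists dec => A cA; have [n dA] := clopen_determined hC cA.
  pose s : {set {ffun 'I_n -> bool}} := [set a | hits code A a]%SET.
  exists (pickle (existT _ n s : {n : nat & {set {ffun 'I_n -> bool}}})).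
  rewrite /dec pickleK; apply/seteqP; split => x /=; rewrite inE (hitsE _ dA).
    by move/asboolP.
  by move=> Ax; apply/asboolP.
pose U (k : nat) : set (GKstar K) :=
  if unpickle k is Some (i, j) then
    if `[< [/\ clopen (e i), clopen (e j) & kval K (e i) = kval K (e j)] >]
    then [set g : GKstar K | balanced_KR (set_val g) (e i) (e j)] else setT
  else setT.
exists U; split.
  move=> k; rewrite /U; case: (unpickle k) => [[i j]|]; last first.
    by split; [exact: openT | move=> O O0 _; rewrite setIT].
  case: asboolP => [[ci cj ij]|_]; last by split;
    [exact: openT | move=> O O0 _; rewrite setIT].
  split; last exact: balanced_KR_dense.
  by exists [set g : GK K | balanced_KR g (e i) (e j)];
    [exact: balanced_KR_open|].
move=> g Ug A B cA cB AB; have [i eA] := he A cA; have [j eB] := he B cB.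
have := Ug (pickle (i, j)) I; rewrite /U pickleK eA eB asboolT //.
by split => //; apply/kval_eq.
Qed.
End Genericity.

(** * Invariant measures of saturated elements *)

Section InvariantMeasures.
Variables (X : ptopologicalType) (R : realType) (K : set (bprob X R)).
Hypothesis hK : dynamical_simplex K.
Variable code : X -> nat -> bool.
Hypothesis hC : coding code.
Implicit Types (A B C U : set X).
Let hV := clopen_val_scale hK hC.

(** Both masses are the sum over the columns of the base mass times the number
   of levels. *)
Lemma saturated_mass (g : GK K) (nu : bprob X R) A B :
    saturated g -> invariant_measure nu g -> clopen A -> clopen B ->
  kval K A = kval K B -> mass nu A = mass nu B.
Proof.
move=> g_sat g_nu cA cB AB.
have [|I [n [C [[[Ccov Ctriv Cne] Ccl Cstep] CA CB cnt]]]] := g_sat A B cA cB.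
  exact/kval_eq.
have C_inj i i' j j' x : (j <= n i)%N -> (j' <= n i')%N -> C i j x ->
  C i' j' x ->
    (i, j) = (i', j').
  by move=> ij ij' xij xij'; apply: Ctriv => //; exists x.
have C_base i j : (j <= n i)%N -> mass nu (C i j) = mass nu (C i 0%N).
  elim: j => // j IH jn; rewrite -Cstep // GK_image_mass //;
    first exact: IH (ltnW jn).
  exact: Ccl (ltnW jn).
have /choice[lab hlab] x : exists p : {i : I & 'I_(n i).+1},
  C (tag p) (tagged p) x.
  have [[i j] /= ij xij] : cover (KR_index n) (fun p =>
    C p.1 p.2) x by rewrite Ccov.
  by exists (Tagged (fun i => 'I_(n i).+1) (Ordinal (ij : (j < (n i).+1)%N))).
have lab_fiber p : [set x | lab x = p] = C (tag p) (tagged p).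
  apply/seteqP; split => [x <- //|x]; case: p => i j /= xij.
  have := hlab x; case: (lab x) => i' j' /= xij'.
  have [ii jj] := C_inj _ _ _ _ x (ltn_ord j' : (j' <= n i')%N) (ltn_ord j :
    (j <= n i)%N) xij' xij.
  by subst i'; congr existT; apply: val_inj.
have key U : clopen U -> union_of_atoms n C U ->
    mass nu U = \sum_i mass nu (C i 0%N) *+ atom_count n C i U.
  move=> cU [D DI UD].
  have cfib p : clopen [set x | lab x = p].
    by rewrite lab_fiber; apply: Ccl; rewrite -ltnS; exact: ltn_ord.
  rewrite (mass_fibers nu cU cfib).
  rewrite (eq_bigr (fun p : {i : I & 'I_(n i).+1} =>
    if `[< C (tag p) (tagged p) `<=` U >]
                             then mass nu (C (tag p) 0%N) else 0)); last first.
    case=> i j _; rewrite lab_fiber /=; case: asboolP => [sU|nsU].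
      by rewrite (setIidr sU) C_base // -ltnS; exact: ltn_ord.
    rewrite (_ : U `&` _ = set0) ?mass0 //; apply/seteqP;
      split => // x [Ux xij].
    apply: nsU; move: Ux; rewrite UD => -[[i' j'] Dij' xij'] y yij.
    have [ii jj] := C_inj _ _ _ _ x (DI _ Dij') (ltn_ord j : (j <= n i)%N)
      xij' xij.
    by exists (i', j') => //=; rewrite ii jj.
  rewrite -(sig_big_dep predT (fun=> predT) (fun i (j : 'I_(n i).+1) =>
     if `[< C i j `<=` U >] then mass nu (C i 0%N) else 0)) /=.
  apply: eq_bigr => i _; rewrite -big_mkcond /= sumr_const /atom_count.
  by congr (_ *+ _); apply: eq_card => j; rewrite !inE.
by rewrite !key //; apply: eq_bigr => i _; rewrite cnt.
Qed.

Section State.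
Variable nu : bprob X R.
Hypothesis nu_val : forall A B, clopen A -> clopen B ->
  kval K A = kval K B -> mass nu A = mass nu B.

Definition state (f : K -> R) : R :=
  mass nu (get [set A | clopen A /\ kval K A = f]).

Lemma stateE A : clopen A -> state (kval K A) = mass nu A.
Proof.
move=> cA; have [cB BA] : [set B | clopen B /\ kval K B = kval K A]
    (get [set B | clopen B /\ kval K B = kval K A]) by apply: getPex; exists A.
exact: nu_val.
Qed.

Lemma state_ge0 f : 0 <= state f.
Proof. exact: mass_ge0. Qed.

Lemma state0 : state 0 = 0.
Proof. by rewrite -(kval0 K) stateE ?mass0 //; exact: clopen0. Qed.

Lemma stateD f f' : clopen_val K f -> clopen_val K f' ->
  clopen_val K (f + f') ->
  state (f + f') = state f + state f'.
Proof.
move=> [A cA fA] [B cB fB] [C cC fC].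
have [|A' [cA' A'C A'A]] := kval_embed hK cA cC.
  by rewrite -fC -fA addrC addKr fB; exact: kval_pos.
have cD := clopen_setD cC cA'.
have fB' : f' = kval K (C `\` A') by rewrite kvalD // A'A -fA -fC addrC addKr.
rewrite fC stateE // fA -A'A stateE // fB' stateE // -massU //.
  by rewrite setDUK.
by rewrite setDE setICA setICr setI0.
Qed.

Lemma state_sum (I : eqType) (s : seq I) (F : I -> K -> R) :
    (forall i, i \in s -> clopen_val K (F i)) ->
      clopen_val K (\sum_(i <- s) F i) ->
  state (\sum_(i <- s) F i) = \sum_(i <- s) state (F i).
Proof.
elim: s => [|i s IH] VF; first by rewrite !big_nil state0.
have VF' j : j \in s -> clopen_val K (F j) by move=> js; apply: VF;
  rewrite inE js orbT.
have VFi := VF i (mem_head i s).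
rewrite !big_cons => Vsum.
have Vs : clopen_val K (\sum_(j <- s) F j).
  rewrite -[X in clopen_val K X](addKr (F i)) addrC; apply: (rs_diff hV) => //.
  rewrite addrC addKr; apply: (scale_pos_sum hV) => j /VF' Vj _;
    exact: (rs_pos hV).
by rewrite stateD // IH.
Qed.

Lemma stateMn f k : clopen_val K f -> clopen_val K (f *+ k) ->
  state (f *+ k) = state f *+ k.
Proof.
have const (V : nmodType) (x : V) : x *+ k = \sum_(i <- iota 0 k) x.
  by rewrite big_const_seq count_predT size_iota iter_addr_0.
by move=> Vf; rewrite !const => Vk; rewrite state_sum.
Qed.

(** Stack the whole space over a base of tiny value and divide the sum of [f]
   over each column by a bound [N] of [f], with remainder: the quotients are
   bounded by the heights of the columns, so that their positive and negative
   parts are values of clopen sets, which [state] compares as the elements of the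
   simplex do; the remainders only contribute [N] times the base. *)
Lemma state_pos (E : finType) (m : E -> K -> R) (f : E -> R) (delta : R) :
    (forall e, clopen_val K (m e)) -> \sum_e m e = kval K setT -> 0 < delta ->
    (forall mu, delta <= \sum_e f e * m e mu) ->
  0 <= \sum_e f e * state (m e).
Proof.
move=> Vm sum_m delta0 hf.
pose N : R := 1 + \sum_e `|f e|.
have N0 : 0 < N by rewrite ltr_pwDl // sumr_ge0.
have fN e : `|f e| <= N.
  by rewrite /N (bigD1 e) //= addrCA lerDl addr_ge0 // sumr_ge0.
have [Z [cZ _ Z0 Zlt]] := small_clopen hK hC (divr_gt0 delta0 N0) clopenT
  (ex_intro _ point I).
have VZ : clopen_val K (kval K Z) by exists Z.
have kZ0 : kval K Z != 0.
  by apply/eqP => /(kval_eq0 hK cZ) eZ; rewrite eZ in Z0; case: Z0.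
have T0 : kval K setT != 0.
  by apply/eqP => /(kval_eq0 hK clopenT) T0; have : [set: X] point by [];
    rewrite T0.
have [S [hS SZ]] := stacking hV Vm sum_m T0 VZ kZ0.
set cnt := fun (t : seq E) e => count_mem e t in hS.
pose F t := \sum_e f e * (cnt t e)%:R.
pose q t := Num.floor (F t / N).
have absF t : `|F t| <= N * (wsize cnt t)%:R.
  rewrite /F /wsize natr_sum mulr_sumr; apply: le_trans (ler_norm_sum _ _ _) _.
  by apply: ler_sum => e _; rewrite normrM normr_nat ler_wpM2r.
have q_le t : F t / N < (q t + 1)%:~R /\ (q t)%:~R <= F t / N.
  by have /andP[] := floor_itv (F t / N).
have q_abs t : (`|q t| <= wsize cnt t)%N.
  have := absF t; rewrite ler_norml => /andP[F1 F2].
  have q1 : - (wsize cnt t)%:Z <= q t.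
    by rewrite /q floor_ge_int intrN ler_pdivlMr // mulNr mulrC.
  have q2 : q t <= (wsize cnt t)%:Z.
    rewrite -(ler_int R); have [_ le] := q_le t; apply: le_trans le _.
    by rewrite ler_pdivrMr // mulrC.
  lia.
pose qp t := `|Num.max (q t) 0|%N; pose qn t := `|Num.max (- q t) 0|%N.
have q_split t : q t = (qp t)%:Z - (qn t)%:Z by rewrite /qp /qn; lia.
have hS0 : column_system (clopen_val K) cnt m (S ++ [::]) by rewrite cats0.
have VS x : x \in S -> clopen_val K x.1 by move=> /hS.1[].
have q_part k : (forall t, (k t <= `|q t|)%N) ->
  clopen_val K (\sum_(x <- S) x.1 *+ k x.2).
  move=> kq; apply: (column_system_part hV sum_m hS0) => x _.
  exact: leq_trans (kq _) (q_abs _).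
pose b := \sum_(x <- S) x.1 *+ qp x.2; pose a := \sum_(x <- S) x.1 *+ qn x.2.
have Vb : clopen_val K b by apply: q_part => t; rewrite /qp; lia.
have Va : clopen_val K a by apply: q_part => t; rewrite /qn; lia.
have columns (ev : (K -> R) -> R) :
    (forall e, ev (m e) = \sum_(x <- S) ev x.1 *+ cnt x.2 e) ->
    \sum_e f e * ev (m e) = \sum_(x <- S) F x.2 * ev x.1.
  move=> hev; under eq_bigr do rewrite hev mulr_sumr.
  rewrite exchange_big /=; apply: eq_bigr => x _; rewrite /F mulr_suml.
  by apply: eq_bigr => e _; rewrite -[ev _ *+ _]mulr_natl mulrA.
have x_ge0 x mu : x \in S -> 0 <= x.1 mu.
  by move=> /VS[A _ ->]; exact: mass_ge0.
have sum_mu (k : seq E -> nat) mu :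
    (\sum_(x <- S) x.1 *+ k x.2) mu = \sum_(x <- S) x.1 mu *+ k x.2.
  by rewrite fct_sumE; apply: eq_bigr => x _; rewrite natmulfctE.
have Fq t : N * (q t)%:~R <= F t /\ F t <= N * (q t)%:~R + N.
  have [lt le] := q_le t; split; first by rewrite mulrC -ler_pdivlMr.
  by move: lt; rewrite ltr_pdivrMr // mulrC intrD mulrDr mulr1 => /ltW.
have ba mu : 0 < b mu - a mu.
  have base : \sum_(x <- S) x.1 mu < delta / N.
    apply: le_lt_trans (Zlt mu).
    have <- : (\sum_(x <- S) x.1) mu = \sum_(x <- S) x.1 mu by rewrite fct_sumE.
    case: SZ => [/eqP|/(_ mu)]; first by rewrite subr_eq0 => /eqP <-.
    by rewrite subr_gt0 => /ltW.
  have ba_q : b mu - a mu = \sum_(x <- S) x.1 mu * (q x.2)%:~R.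
    rewrite /b /a !sum_mu -sumrB; apply: eq_bigr => x _.
    by rewrite q_split rmorphB /= -!pmulrn mulrBr !mulr_natr.
  have := hf mu; rewrite (columns (fun g => g mu)) => [le|e]; last first.
    by rewrite -[LHS](congr1 (@^~ mu) (hS.2 e)) sum_mu.
  have : delta <= N * (b mu - a mu) + N * \sum_(x <- S) x.1 mu.
    apply: le_trans le _; rewrite ba_q !mulr_sumr -big_split /= big_seq
      [leRHS]big_seq.
    apply: ler_sum => x xS; have [_ F_le] := Fq x.2.
    apply: le_trans (ler_wpM2r (x_ge0 x mu xS) F_le) _.
    by rewrite mulrDl mulrAC -mulrA.
  have : N * \sum_(x <- S) x.1 mu < delta by rewrite mulrC -ltr_pdivlMr.
  by move=> lt1 lt2; rewrite -(pmulr_rgt0 _ N0); lra.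
have Vba : clopen_val K (b - a) by apply: (rs_diff hV) => //; right => mu;
  exact: ba.
have state_ab : state a <= state b.
  have e : b = a + (b - a) by rewrite addrC subrK.
  by rewrite e stateD ?lerDl ?state_ge0 // -e.
have Vxk (k : seq E -> nat) x : clopen_val K (\sum_(y <- S) y.1 *+ k y.2) ->
  x \in S ->
    clopen_val K (x.1 *+ k x.2).
  move=> Vk xS; apply: (scaleMn hV (VS x xS)).
  have -> : kval K setT - x.1 *+ k x.2 = kval K setT - \sum_(y <- S) y.1 *+ k
    y.2 +
      \sum_(y <- rem x S) y.1 *+ k y.2.
    by rewrite (perm_big _ (perm_to_rem xS)) big_cons /= opprD addrA subrK.
  apply: null_or_posD.
    have [D cD ->] := Vk; rewrite -kvalD //; [|exact: clopenT].
    by apply: kval_pos => //; apply: clopen_setD => //; exact: clopenT.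
  apply: (scale_pos_sum hV) => y /mem_rem yS _.
  exact: scale_posMn hV _ _ (rs_pos hV (VS y yS)).
have state_part (k : seq E ->
  nat) : clopen_val K (\sum_(y <- S) y.1 *+ k y.2) ->
    state (\sum_(y <- S) y.1 *+ k y.2) = \sum_(y <- S) state y.1 *+ k y.2.
  move=> Vk; rewrite state_sum //; last by move=> x; exact: Vxk.
  rewrite [LHS]big_seq [RHS]big_seq; apply: eq_bigr => x xS; rewrite stateMn //.
    exact: VS.
  exact: Vxk.
rewrite columns; last first.
  by move=> e; rewrite -{1}hS.2 (state_part (fun t => cnt t e)) // hS.2.
apply: (@le_trans _ _ (N * (state b - state a))).
  by rewrite pmulr_rge0 // subr_ge0.
rewrite /b /a !state_part // -sumrB mulr_sumr big_seq [leRHS]big_seq.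
apply: ler_sum => x xS; have [F_ge _] := Fq x.2.
rewrite -[_ *+ qp _]mulr_natr -[_ *+ qn _]mulr_natr -mulrBr mulrCA mulrC;
  apply: ler_wpM2r; first exact: state_ge0.
by move: F_ge; rewrite q_split rmorphB /= -!pmulrn.
Qed.

End State.

Lemma bprob_convex (mu rho : bprob X R) (t : R) : 0 <= t <= 1 ->
  exists sigma : bprob X R, forall A : set (borel X), measurable A ->
    sigma A = (t%:E * mu A + (1 - t)%:E * rho A)%E.
Proof.
move=> /andP[t0 t1]; have t1' : 0 <= 1 - t by rewrite subr_ge0.
pose m : {measure set (borel X) -> \bar R} :=
  measure_add (mscale (NngNum t0) mu) (mscale (NngNum t1') rho).
have mE A : m A = (t%:E * mu A + (1 - t)%:E * rho A)%E by exact: measure_addE.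
have m1 : m setT = 1%E.
  rewrite mE; have -> : mu setT = 1%E by exact: probability_setT.
  have -> : rho setT = 1%E by exact: probability_setT.
  by rewrite !mule1 -EFinD addrC subrK.
pose P := Measure_isProbability.Build _ _ _ m m1.
pose p : probability (borel X) R := HB.pack (Measure.sort m) P.
have [sigma hs] := bprob_exists p.
by exists sigma => A mA; rewrite hs // -mE.
Qed.

Lemma continuous_sum (T : topologicalType) (I : finType) (F : I -> T -> R) :
  (forall i, continuous (F i)) -> continuous (fun x => \sum_i F i x).
Proof.
move=> cF; rewrite -fct_sumE;
  apply: (big_ind (fun f : T -> R => continuous f)) => [|f f' cf cf' x|i _];
  last exact: cF.
  exact: cst_continuous.
by apply: continuousD; [exact: cf | exact: cf'].
Qed.

Lemma determined_mass (mu rho : bprob X R) n A :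
    (forall e, mass mu [set x | bits code n x = e] = mass rho [set x | bits
      code n x = e]) ->
  determined code n A -> mass mu A = mass rho A.
Proof.
move=> mr dA; have cA := determined_clopen hC dA.
rewrite !(mass_fibers (p := bits code n) _ cA (bits_clopen hC (n := n))).
apply: eq_bigr => e _; have [/asboolP[x Ax xe]|/asboolP nAe] :=
  boolP (hits code A e).
  rewrite (_ : A `&` _ = [set x | bits code n x = e]) //.
  apply/seteqP; split => [y []//|y ye]; split => //.
  by apply: dA Ax; apply/bitsP; rewrite xe ye.
rewrite (_ : A `&` _ = set0) ?mass0 //; apply/seteqP; split => // x [Ax xe].
by apply: nAe; exists x.
Qed.

(** By compactness finitely many cylinders suffice to tell [nu] from the elements
   of the simplex; in the space of the masses of these cylinders the image of the
   simplex is a compact convex set, and the functional is given by its point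
   nearest to [nu]. *)
Lemma simplex_separation (nu : bprob X R) : ~ K nu ->
  exists (n : nat) (d : {ffun 'I_n -> bool} -> R) (c : R), 0 < c /\
    forall mu, K mu -> \sum_e d e * mass nu [set x | bits code n x = e] + c <=
                       \sum_e d e * mass mu [set x | bits code n x = e].
Proof.
move=> nKnu; pose ms mu n e := mass mu [set x | bits code n x = e] : R.
have cb n e : clopen [set x | bits code n x = e] by exact: bits_clopen.
pose dist n (mu : bprob X R) := \sum_e (ms mu n e - ms nu n e) ^+ 2.
have cdist n : continuous (dist n).
  apply: continuous_sum => e; pose f mu := ms mu n e - ms nu n e.
  have cf : continuous f.
    have -> : f = (fun mu => ms mu n e) - cst (ms nu n e) by [].
    by move=> mu; apply: continuousB;
      [exact: mass_continuous | exact: cst_continuous].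
  have -> : (fun mu => (ms mu n e - ms nu n e) ^+ 2) = f \* f.
    by apply/funext => mu; rewrite expr2.
  by move=> mu; apply: continuousM; exact: cf.
have dist_ge0 n mu : 0 <= dist n mu by apply: sumr_ge0 => e _; exact: sqr_ge0.
have dist0 n mu A : ~ 0 < dist n mu -> determined code n A ->
  mass mu A = mass nu A.
  move=> /negP; rewrite -leNgt => d0; apply: determined_mass => e.
  have : dist n mu == 0 by rewrite eq_le d0 dist_ge0.
  rewrite psumr_eq0 => [/allP/(_ e (mem_index_enum _))|f _];
    last exact: sqr_ge0.
  by rewrite sqrf_eq0 subr_eq0 => /eqP.
have [|||n Kn] := compact_chain (O := fun n =>
  [set mu | 0 < dist n mu]) (ds_compact hK).
- by move=> n; move/continuousP : (cdist n) => /(_ [set r | 0 < r]); apply;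
  exact: open_gt.
- move=> n mu /= dn; apply: contrapT => /dist0 dn1; move: dn.
  rewrite /dist big1 ?ltxx // => e _; rewrite /ms dn1 ?subrr ?expr0n //.
  by move=> x y xy /= <-; apply/bitsP => k kn; rewrite xy // ltnW.
- move=> mu Kmu; apply: contrapT => no_n; apply: nKnu.
  suff -> : nu = mu by [].
  apply: (clopen_bprob_eq hC) => A cA; have [n dA] := clopen_determined hC cA.
  by apply/esym/(dist0 n) => // dn; apply: no_n; exists n.
have [q Kq q_min] := compact_EVT_min (ds_nonempty hK) (ds_compact hK)
  (continuous_subspaceT (cdist n)).
have {}Kq : K q by exact: set_mem.
pose d e := ms q n e - ms nu n e.
exists n, d, (dist n q); split; first exact: Kn.
move=> mu Kmu; pose w e := ms mu n e - ms q n e; pose s := \sum_e d e * w e.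
suff s0 : 0 <= s.
  have -> : \sum_e d e * mass mu [set x | bits code n x = e] =
      \sum_e d e * mass nu [set x | bits code n x = e] + dist n q + s.
    rewrite /dist /s -!big_split /=; apply: eq_bigr => e _.
    by rewrite /w /d /ms; ring.
  by rewrite lerDl.
rewrite leNgt; apply/negP => s_lt0; pose W := 1 + \sum_e w e ^+ 2.
have W1 : 1 <= W by rewrite lerDl; apply: sumr_ge0 => e _; exact: sqr_ge0.
(* As [2 s] is the derivative at [q] of the squared distance in the direction of
   [mu], a small step [t] in this direction would bring [q] nearer to [nu]. *)
pose t := Num.min 1 (- s / W).
have t0 : 0 < t by rewrite lt_min ltr01 divr_gt0 ?oppr_gt0 //; lra.
have t1 : t <= 1 by rewrite ge_min lexx.
have tW : t * W <= - s.
  by rewrite -ler_pdivlMr; [rewrite ge_min lexx orbT | lra].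
have [|rho rhoE] := bprob_convex mu q (t := t); first by rewrite ltW.
have Krho : K rho by apply: (ds_convex hK Kmu Kq) rhoE; rewrite ltW.
have : dist n q <= dist n rho by apply: q_min; exact: mem_set.
have ms_rho e : ms rho n e = ms q n e + t * w e.
  rewrite /ms /mass rhoE; last exact: clopen_measurable.
  rewrite -!(massK _ (cb n e)) -!EFinM -EFinD /= /w /ms; ring.
have -> : dist n rho = dist n q + t * (2 * s + t * \sum_e w e ^+ 2).
  rewrite /dist /s !mulr_sumr -big_split mulr_sumr -big_split /=.
  by apply: eq_bigr => e _; rewrite ms_rho /d; ring.
rewrite lerDl pmulr_rge0 //.
have -> : \sum_e w e ^+ 2 = W - 1 by rewrite /W addrAC subrr add0r.
lra.
Qed.

(** Otherwise the separating function, shifted by a constant, has a positive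
   integral for the elements of the simplex and a negative one for [nu], which
   contradicts the comparison above. *)
Theorem state_in_simplex (nu : bprob X R) :
    (forall A B, clopen A -> clopen B -> kval K A = kval K B ->
      mass nu A = mass nu B) ->
  K nu.
Proof.
move=> nu_val; apply: contrapT => nKnu.
have [n [d [c [c0 hsep]]]] := simplex_separation nKnu.
pose m (e : {ffun 'I_n -> bool}) := kval K [set x | bits code n x = e].
pose t := \sum_e d e * mass nu [set x | bits code n x = e] + c / 2.
pose f e := d e - t.
have cb e : clopen [set x | bits code n x = e] by exact: bits_clopen.
have sum_m : \sum_e m e = kval K setT.
  rewrite (kval_fibers K (p := bits code n) clopenT) //.
  by apply: eq_bigr => e _; rewrite setTI.
have sum_f (mu : bprob X R) : \sum_e f e * mass mu [set x | bits code n x = e] =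
    \sum_e d e * mass mu [set x | bits code n x = e] - t.
  rewrite /f; under eq_bigr do rewrite mulrBl; rewrite sumrB -mulr_sumr;
    congr (_ - _).
  rewrite -[RHS]mulr1 -(massT mu) (mass_fibers (p :=
    bits code n) mu clopenT) //.
  by congr (_ * _); apply: eq_bigr => e _; rewrite setTI.
have Vm e : clopen_val K (m e) by exists [set x | bits code n x = e].
have c2 : 0 < c / 2 by rewrite divr_gt0.
have := state_pos nu_val Vm sum_m c2 (f := f).
have -> : \sum_e f e * state nu (m e) = \sum_e f e * mass nu [set x | bits
  code n x = e].
  by apply: eq_bigr => e _; rewrite (stateE nu_val (cb e)).
rewrite sum_f => h.
have : 0 <= \sum_e d e * mass nu [set x | bits code n x = e] - t.
  apply: h => mu; rewrite sum_f /t; have := hsep _ (set_valP mu); lra.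
by rewrite /t; lra.
Qed.
End InvariantMeasures.

Theorem theorem3p1 (R : realType) (X : ptopologicalType)
    (hX : is_cantor_space X) (K : set (bprob X R))
    (hK : dynamical_simplex K) :
  comeager [set g : GKstar K | saturated (set_val g)] /\
  comeager [set g : GKstar K |
    [set mu : bprob X R | invariant_measure mu (set_val g)] = K].
Proof.
have [code hC] := cantor_coding hX.
have [U [hU U_sat]] := comeager_saturated hK hC.
split; first by exists U.
exists U; split => // g /U_sat g_sat.
apply/seteqP; split => [nu g_nu|mu Kmu]; last exact: GK_inv.
apply: (state_in_simplex hK hC) => A B cA cB.
exact: saturated_mass g_sat g_nu cA cB.
Qed.
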